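(* Let $\{X(k)\}_{k\ge0}$ be the backward recurrence time chain on $\{0,1,\dots\}$ with parameters $\{p_i\}_{i\ge0}$, as described in the context. (i) Suppose there exist $i_0\in\mathbb{N}$ and $\alpha>1$ such that $p_i=1-\frac{1+\alpha}{i}$ for $i\ge i_0$. Let $\pi$ be the unique invariant probability measure of the chain. For any $\beta\in[2/(1+\alpha),1)$ put $$\mathcal{V}(i)=i^{\beta(1+\alpha)}+1,\quad\phi(t)=t^{1-\frac{1}{\beta(1+\alpha)}},\quad\eta=\beta(1+\alpha)-1,\quad\Phi(t)=\int_1^t\frac{ds}{\phi(s)},\quad r(t)=\phi\circ\Phi^{-1}(t),\quad\overline m_\eta=\sum_{i\ge0}i^\eta\,\pi(i).$$ Then there exists $\bar c>0$ such that $$\left(1\vee r(k)^{(\eta-1)/\eta}\right)\mathcal{W}_1(\delta_iP_k,\pi)\le\bar c\,\mathcal{V}(i)\qquad\forall k,i\in\{0,1,\dots\},$$ $$\sum_{k=0}^\infty\left(1\vee r(k)^{(\eta-1)/\eta}\right)\mathcal{W}_1(\delta_iP_k,\delta_jP_k)\le\bar c\,(\mathcal{V}(i)+\mathcal{V}(j))\qquad\forall i,j\in\{0,1,\dots\},$$ and for any $p\in[1,\eta]$ there exists $\tilde c>0$ such that $$\left(1\vee\left(k^{(\eta-p)/p}\wedge\left[k^{(1-p)/p}r(k)^{(\eta-1)/(p\eta)}\right]\right)\right)\mathcal{W}_p(\delta_iP_k,\pi)\le\tilde c\,(\mathcal{V}(i)+\overline m_\eta)\qquad\forall k,i\in\{0,1,\dots\}.$$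 (ii) Suppose there exist $i_0\in\mathbb{N}$ and $\alpha>1$ such that $p_i=1-\frac{1+\alpha}{i}$ for $i\ge i_0$. Then $\pi\in\mathcal{P}_{\alpha-\iota}(\{0,1,\dots\})$ for every $\iota\in(0,\alpha)$. Next, fix $\rho\in(0,(\alpha-1)\wedge1)$ and $\varepsilon\in[\rho,1)$, and put $\theta=1+\alpha-\rho$, $\vartheta=\alpha-\rho$, $\mathcal{V}(i)=i^{\theta}+1$. Then, for every $p\in[1,\alpha-\rho]$, $\iota\in(0,1-\varepsilon)$ and $i\in\{0,1,\dots\}$, there exist a constant $\bar c>0$ and a diverging increasing sequence $\{t_n\}_{n\in\mathbb{N}}\subset\{0,1,\dots\}$, depending on these parameters, such that $$\mathcal{W}_p(\delta_iP_{t_n},\pi)\ge\bar c\,(t_n+\mathcal{V}(i))^{-\frac{\vartheta-p+\varepsilon+\iota}{(\theta-\vartheta-\varepsilon-\iota)p}}\qquad\forall n\in\mathbb{N}.$$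
   Context: Let $\{p_i\}_{i\ge0}\subset(0,\infty)$ with $p_0=1$, $p_i<1$ for $i\in\mathbb{N}=\{1,2,\dots\}$, and $\prod_{j=0}^ip_j\to0$ as $i\to\infty$. The backward recurrence time chain $\{X(k)\}_{k\ge0}$ is the Markov chain on $\{0,1,\dots\}$ with one-step transition probabilities $p(i,i+1)=1-p(i,0)=p_i$, $i\ge0$. It is irreducible and aperiodic, and it admits a unique invariant probability measure $\pi$ if and only if $c:=\sum_{i=1}^\infty\prod_{j=1}^ip_j<\infty$, in which case $\pi(0)=\pi(1)=(2+c)^{-1}$ and $\pi(i)=(2+c)^{-1}\prod_{j=0}^{i-1}p_j$ for $i\ge2$. $\delta_iP_k$ is the law of $X(k)$ given $X(0)=i$. The state space carries the metric $|i-j|$; $\mathcal{P}_p(\{0,1,\dots\})$ is the set of probability measures with finite $p$-th moment; $\mathcal{W}_p(\mu_1,\mu_2)=\inf_\Pi\left(\sum_{i,j}|i-j|^p\,\Pi(i,j)\right)^{1/p}$ over couplings $\Pi$ of $\mu_1,\mu_2$. $\vee,\wedge$ denote maximum and minimum. At $k=0$ we use $0^0=1$ and, for $p>1$, $k^{(1-p)/p}=+\infty$. *)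

(* Defs.v *)
From HB Require Import structures.
From mathcomp Require Import all_boot all_order all_algebra.
From mathcomp Require Import all_classical all_reals all_analysis.
From mathcomp Require Import measurable_realfun.

Set Implicit Arguments.
Unset Strict Implicit.
Unset Printing Implicit Defensive.

Import Order.TTheory GRing.Theory Num.Theory.
Import numFieldNormedType.Exports.

Local Open Scope classical_set_scope.
Local Open Scope ring_scope.
Local Open Scope ereal_scope.

Definition brt_params (R : realType) (p_ : nat -> R) : Prop :=
  [/\ forall i, (0 < p_ i)%R,
      p_ 0%N = 1%R,
      forall i, (0 < i)%N -> (p_ i < 1)%R
    & (\prod_(0 <= j < i.+1) p_ j)%R @[i --> \oo] --> (0 : R)%R].

Section transition_kernel.
Context {R : realType}.
Variable p_ : nat -> R.

Definition jump (i : nat) (b : bool) : nat := if b then i.+1 else 0%N.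

Let measurable_jump i : measurable_fun [set: bool] (jump i).
Proof. by []. Qed.

HB.instance Definition _ i :=
  isMeasurableFun.Build _ _ bool nat (jump i) (measurable_jump i).

Definition brt_kernel (i : nat) : {measure set nat -> \bar R} :=
  distribution (bernoulli_prob (p_ i)) (jump i).

Let measurable_brt_kernel (U : set nat) :
  measurable U ->
  measurable_fun [set: nat] (brt_kernel ^~ U).
Proof. by []. Qed.

HB.instance Definition _ :=
  isKernel.Build _ _ nat nat R brt_kernel measurable_brt_kernel.

Let brt_kernel_setT i : brt_kernel i [set: nat] = 1.
Proof. exact: probability_setT. Qed.

HB.instance Definition _ :=
  Kernel_isProbability.Build _ _ nat nat R brt_kernel brt_kernel_setT.

Lemma brt_kernelE i (A : set nat) : (0 <= p_ i <= 1)%R ->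
  brt_kernel i A = (p_ i)%:E * \d_(i.+1) A + (1 - p_ i)%:E * \d_(0%N) A.
Proof.
move=> pi01; rewrite -[LHS]/(bernoulli_prob (p_ i) (jump i @^-1` A)).
by rewrite bernoulli_probE.
Qed.

End transition_kernel.

(* [kernel_iter K k x] is the law after [k] steps of the kernel [K] started
   from [x]; for a Markov chain on [nat], see [distribution_markov_chain]. *)
Fixpoint kernel_iter {R : realType} d (T : measurableType d)
    (K : R.-spker T ~> T) (k : nat) : R.-spker T ~> T :=
  if k is k'.+1 then mkcomp_noparam (kernel_iter K k') K
  else kdirac (@measurable_id _ T setT).

Definition invariant_measure {R : realType} d (T : measurableType d)
    (K : R.-spker T ~> T) (mu : probability T R) : Prop :=
  forall A, measurable A -> \int[mu]_x K x A = mu A.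

Definition markov_chain_from {R : realType} (K : R.-pker nat ~> nat) (i : nat)
    d (Om : measurableType d) (Q : probability Om R)
    (X : nat -> {mfun Om >-> nat}) : Prop :=
  Q (X 0%N @^-1` [set i]) = 1 /\
  forall k x (A : set Om) (B : set nat),
    <<s \bigcup_(m in `I_k.+1)
          preimage_set_system [set: Om] (X m) measurable >> A ->
    Q (A `&` X k @^-1` [set x] `&` X k.+1 @^-1` B)
      = Q (A `&` X k @^-1` [set x]) * K x B.

Lemma ge0_integral_nat {R : realType} (mu : {measure set nat -> \bar R})
    (f : nat -> \bar R) : (forall i, 0 <= f i) ->
  \int[mu]_i f i = \sum_(0 <= i <oo) f i * mu [set i].
Proof.
move=> f0.
have -> : [set: nat] = \bigcup_i [set i] :> set nat.
  by apply/seteqP; split => // i _; exists i.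
rewrite ge0_integral_bigcup//; last by apply/trivIsetP => i j _ _ /eqP ij;
  apply/seteqP; split => // x [/= -> /ij].
apply: eq_eseriesr => i _.
rewrite (eq_integral (cst (f i))) ?integral_cst//.
by move=> x /set_mem ->.
Qed.

Lemma distribution_markov_chain {R : realType} (K : R.-pker nat ~> nat) i
    d (Om : measurableType d) (Q : probability Om R)
    (X : nat -> {mfun Om >-> nat}) : markov_chain_from K i Q X ->
  forall k A, distribution Q (X k) A = kernel_iter K k i A.
Proof.
move=> [X0 XM]; elim=> [|k IH] A.
  rewrite -[LHS]/(Q (X 0%N @^-1` A)) -[RHS]/(\d_i A) diracE.
  have mX B : measurable (X 0%N @^-1` B).
    by rewrite -(setTI (_ @^-1` _)); exact: measurable_funP.
  have X0C : Q (X 0%N @^-1` (~` [set i])) = 0.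
    by rewrite -preimage_setC probability_setC// X0 subee.
  have [/set_mem Ai|/negP Ai] := boolP (i \in A).
    apply/eqP; rewrite eq_le probability_le1//= -X0.
    by apply: le_measure; rewrite ?inE// => w /= ->.
  apply/eqP; rewrite eq_le measure_ge0 andbT -[leRHS]/(0 : \bar R) -X0C.
  apply: le_measure; rewrite ?inE// => w /= Aw wi.
  by apply: Ai; rewrite inE -wi.
rewrite -[RHS]/(\int[kernel_iter K k i]_x K x A).
rewrite ge0_integral_nat//.
have mX m B : measurable (X m @^-1` B).
  by rewrite -(setTI (_ @^-1` _)); exact: measurable_funP.
have -> : distribution Q (X k.+1) A
    = \sum_(0 <= x <oo) Q (X k @^-1` [set x] `&` X k.+1 @^-1` A).
  rewrite -[LHS]/(Q (X k.+1 @^-1` A)).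
  rewrite [X in Q X = _](_ : _ =
      \bigcup_x (X k @^-1` [set x] `&` X k.+1 @^-1` A)); last first.
    by apply/seteqP; split => [w Aw|w [x _ []]//]; exists (X k w).
  rewrite measure_bigcup//.
  - by apply: eq_eseriesl => x; rewrite in_setT.
  - by move=> x _; exact: measurableI.
  apply/trivIsetP => x y _ _ /eqP xy.
  by apply/seteqP; split => // w [/= [-> _] [/xy]].
apply: eq_eseriesr => x _.
rewrite -IH -[in LHS](setTI (X k @^-1` [set x])) XM ?setTI 1?muleC//.
set G := \bigcup_(_ in _) _.
have [G0 GD _] := smallest_sigma_algebra [set: Om] G.
by have := GD _ G0; rewrite setD0.
Qed.

Definition brt_law {R : realType} (p_ : nat -> R) (i k : nat) :
    {measure set nat -> \bar R} :=
  kernel_iter (brt_kernel p_) k i.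

Section wasserstein.
Context {R : realType}.
Implicit Types mu nu : {measure set nat -> \bar R}.

Definition coupling mu nu : set (probability (nat * nat)%type R) :=
  [set Pi | pushforward Pi fst =1 mu /\ pushforward Pi snd =1 nu].

Definition wasserstein (p : R) mu nu : \bar R :=
  ereal_inf [set (\esum_(z in [set: nat * nat])
      ((`|z.1%:R - z.2%:R| `^ p)%:E * Pi [set z])) `^ p^-1
    | Pi in coupling mu nu].

Definition moment (p : R) mu : \bar R :=
  \sum_(0 <= i <oo) (i%:R `^ p)%:E * mu [set i].

End wasserstein.

Section rates.
Context {R : realType}.
Local Open Scope ring_scope.

Definition lyapunov (a : R) (i : nat) : R := i%:R `^ a + 1.

Definition phi (theta t : R) : R := t `^ (1 - 1 / theta).

Definition Phi (theta t : R) : R :=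
  \int[lebesgue_measure]_(s in `[1, t]) (phi theta s)^-1.

(* [Phi theta] is inverted as a bijection from [1, +oo[ onto [0, +oo[. *)
Definition rate (theta t : R) : R :=
  phi theta ('pinv_(fun=> 1) `[1, +oo[ (Phi theta) t).

(* [k ^ a] with the convention [0 ^ a = +oo] for [a < 0]; the library's [`^]
   has [0 `^ a = 0] there. *)
Definition natpow (k : nat) (a : R) : \bar R :=
  if (k == 0%N) && (a < 0) then +oo%E else (k%:R `^ a)%:E.

End rates.

(* Main.v *)
(* Write a = 1 + alpha.  Run two copies of the chain with the same uniform
   variables.  While both are positive and the larger one, M, is large, a jump
   of M to 0 is also a jump of the smaller one, so the copies meet; hence M
   survives n steps with probability about (M / (M + n)) ^ a.  The only loss
   is when the smaller copy sits at 0, where p_0 = 1 forbids meeting.  A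
   supermartingale (see [potential]) shows that for every exponent th < a the
   probability of not having met after n steps is at most
   C ((M + 1) / (M + 1 + n)) ^ th.  Before meeting, the distance is at most
   M + n, and integrating (M + n) ^ p times this tail gives all upper bounds:
   th = eta for the polynomial rates, th > theta for the summability.
   For the lower bound, X(k) <= i + k, whereas pi gives mass of order L ^ - alpha
   to [2 L, 4 L[; with L of order i + k any coupling pays at least
   L ^ (p - alpha), which already dominates the claimed rate along t_n = n. *)

Require Import Defs.
From HB Require Import structures.
From mathcomp Require Import all_boot all_order all_algebra.
From mathcomp Require Import all_classical all_reals all_analysis.
From mathcomp Require Import measurable_realfun.
From mathcomp Require Import ring lra zify.

Set Implicit Arguments.
Unset Strict Implicit.
Unset Printing Implicit Defensive.

Import Order.TTheory GRing.Theory Num.Theory.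
Import numFieldNormedType.Exports.

Local Open Scope classical_set_scope.
Local Open Scope ring_scope.

(** * Power estimates *)

(** The gap a - th = 2 kap is the budget of the supermartingale. If every jump of M merged the
    copies, [decay] alone would do, because (1 - a / M) exp (th / M) < 1. The obstacle is the pair
    (M, 0): its two exits are (M + 1, 1) and (0, 1), so no mass is lost in that step. As [decay] is
    1 everywhere at n = 0 and below 1 at n = 1, it fails there for every th > 0, however small. Two
    corrections restore the inequality. A surplus kap / M at N = 0 is released when the pair moves
    on to (M + 1, 1), and large M is valued 4 a / kap times higher than small M, so that this
    surplus exceeds the value of the mass a / M sent to (0, 1). On pairs with N > 0 both corrections
    are costs: the exponents there add up to - a + th + kap + kap / 8, which is negative. For states
    below [i1] no formula for p_ is available; only bounds on p_ away from 0 and 1 enter there, and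
    the constants are arranged so that [decay] hardly varies on that range. *)

Section power_estimates.
Context {R : realType}.
Implicit Types x y s t : R.

(** This is ln (1 + u) <= u. The one-step comparisons of [decay], of the factor [A] and of the
    invariant masses go through it, so that products are compared by adding exponents. *)
Lemma powR_ratio_le x y t : 0 < x -> 0 < y -> 0 <= t ->
  (y / x) `^ t <= expR (t * ((y - x) / x)).
Proof.
move=> x0 y0 t0; have yx0 : 0 < y / x by rewrite divr_gt0.
rewrite /powR gt_eqF// ler_expR ler_wpM2l//.
have -> : y / x = 1 + (y - x) / x by field; rewrite gt_eqF.
apply: le_ln1Dx; rewrite -subr_gt0 opprK addrC.
by have -> : 1 + (y - x) / x = y / x by field; rewrite gt_eqF.
Qed.

Lemma expR_le1D2x x : 0 <= x -> x <= 1 / 2 -> expR x <= 1 + 2 * x.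
Proof.
move=> x0 x1; have := expR_ge1Dx (- x); rewrite expRN => h.
have e0 := expR_gt0 x.
have := ler_wpM2r (ltW e0) h; rewrite mulVf ?gt_eqF//; nra.
Qed.

(** A discrete form of integrating x ^ (- s). Convexity gives the difference of x ^ (1 - s) over one
    unit as at least (s - 1) (x + 1) ^ (- s), and x + 1 <= 2 x costs the factor 2 ^ s. *)
Lemma powRN_telescope s x : 1 < s -> 1 <= x ->
  x `^ (- s) <= 2 `^ s / (s - 1) * (x `^ (1 - s) - (x + 1) `^ (1 - s)).
Proof.
move=> s1 x1.
have x0 : 0 < x by lra.
have xS0 : 0 < x + 1 by lra.
have h1 : (x + 1) `^ (1 - s) * (1 + (s - 1) / (x + 1)) <= x `^ (1 - s).
  have E : x = (x + 1) * (x / (x + 1)) by field; rewrite gt_eqF.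
  rewrite {3}E powRM ?(ltW xS0)//; last by rewrite divr_ge0// ltW.
  rewrite ler_wpM2l ?powR_ge0//.
  have q0 : 0 < x / (x + 1) by rewrite divr_gt0.
  rewrite /powR gt_eqF//; apply: le_trans (expR_ge1Dx _).
  rewrite lerD2l.
  have : ln (1 + - (x + 1)^-1) <= - (x + 1)^-1.
    apply: le_ln1Dx; rewrite ltrN2 invf_lt1//; lra.
  have -> : 1 + - (x + 1)^-1 = x / (x + 1) by field; rewrite gt_eqF.
  nra.
have h2 : (2 * x) `^ (- s) <= (x + 1) `^ (- s).
  rewrite !powRN lef_pV2 ?posrE ?powR_gt0 ?mulr_gt0//.
  by apply: ge0_ler_powR; rewrite ?nnegrE; lra.
have h3 : (x + 1) `^ (1 - s) = (x + 1) * (x + 1) `^ (- s).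
  rewrite powRD ?powRr1 ?(ltW xS0)//.
  by apply/implyP => _; rewrite gt_eqF.
have h4 : (2 * x) `^ (- s) = (2 `^ s)^-1 * x `^ (- s).
  by rewrite powRM ?powRN//; lra.
have p2 : 0 < (2 : R) `^ s by rewrite powR_gt0.
have : (s - 1) * (2 * x) `^ (- s) <= x `^ (1 - s) - (x + 1) `^ (1 - s).
  apply: (@le_trans _ _ ((s - 1) * (x + 1) `^ (- s))).
    by rewrite ler_wpM2l//; lra.
  rewrite lerBrDl; apply: le_trans h1.
  rewrite h3 mulrDr mulr1 lerD2l.
  suff -> : (x + 1) * (x + 1) `^ (- s) * ((s - 1) / (x + 1)) =
    (s - 1) * (x + 1) `^ (- s) by [].
  by field; rewrite gt_eqF.
rewrite h4 => h5.
have -> : x `^ (- s) = 2 `^ s / (s - 1) * ((s - 1) * ((2 `^ s)^-1 * x `^ (- s))).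
  by field; rewrite !gt_eqF//; lra.
rewrite ler_wpM2l// divr_ge0// ?powR_ge0//; lra.
Qed.

Lemma sum_powRN_le s x n : 1 < s -> 1 <= x ->
  \sum_(0 <= k < n) (x + k%:R) `^ (- s) <= 2 `^ s / (s - 1) * x `^ (1 - s).
Proof.
move=> s1 x1; have C0 : 0 <= 2 `^ s / (s - 1).
  by rewrite divr_ge0 ?powR_ge0//; lra.
apply: (@le_trans _ _ (2 `^ s / (s - 1) * (x `^ (1 - s) - (x + n%:R) `^ (1 - s)))).
  elim: n => [|n IH]; first by rewrite big_nil addr0 subrr mulr0.
  rewrite big_nat_recr//=.
  have := @powRN_telescope s (x + n%:R) s1.
  have n0 : 0 <= n%:R :> R by [].
  move=> /(_ ltac:(lra)); rewrite -(natr1 n) addrA; nra.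
by rewrite ler_wpM2l// lerBlDr lerDl powR_ge0.
Qed.

End power_estimates.

(** * Meeting time of two coupled chains *)

Section pair_chain.
Context {R : realType}.
Variable p_ : nat -> R.

(* Both coordinates use the same uniform variable: [x] moves up iff it is
   below [p_ x], so from two distinct states the pair meets at [(0, 0)] only. *)
Definition pair_step (f : nat -> nat -> R) (x y : nat) : R :=
  Num.min (p_ x) (p_ y) * f x.+1 y.+1
  + (p_ x - Num.min (p_ x) (p_ y)) * f x.+1 0%N
  + (p_ y - Num.min (p_ x) (p_ y)) * f 0%N y.+1
  + (1 - Num.max (p_ x) (p_ y)) * f 0%N 0%N.

(** The mean of [f] at the pair after n steps, as a function of the starting pair. The diagonal is
    never left, so for the indicator of x != y this is the probability of not having met. *)
Definition pair_iter (n : nat) (f : nat -> nat -> R) : nat -> nat -> R :=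
  iter n pair_step f.

Definition offdiag (h : nat -> nat -> R) (x y : nat) : R :=
  if x == y then 0 else h (maxn x y) (minn x y).

Hypothesis p01 : forall i, 0 <= p_ i <= 1.

Lemma pair_step_le f g x y :
  f x.+1 y.+1 <= g x.+1 y.+1 -> f x.+1 0%N <= g x.+1 0%N ->
  f 0%N y.+1 <= g 0%N y.+1 -> f 0%N 0%N <= g 0%N 0%N ->
  pair_step f x y <= pair_step g x y.
Proof.
have /andP[px0 px1] := p01 x; have /andP[py0 py1] := p01 y.
move=> h1 h2 h3 h4; rewrite /pair_step.
by rewrite !lerD// ler_wpM2l// ?subr_ge0 ?le_min ?ge_min ?ge_max ?px0 ?px1
  ?lexx ?orbT ?py0.
Qed.

Lemma pair_stepC f x y : (forall x y, f x y = f y x) ->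
  pair_step f x y = pair_step f y x.
Proof.
move=> fC; rewrite /pair_step minC maxC (fC x.+1 y.+1) (fC x.+1 0%N) (fC 0%N y.+1).
ring.
Qed.

Lemma pair_step_diag f x : f x.+1 x.+1 = 0 -> f 0%N 0%N = 0 ->
  pair_step f x x = 0.
Proof. by move=> f1 f0; rewrite /pair_step minxx subrr f1 f0; ring. Qed.

Lemma offdiagC h x y : offdiag h x y = offdiag h y x.
Proof. by rewrite /offdiag eq_sym maxnC minnC. Qed.

Lemma offdiag_gt h x y : (y < x)%N -> offdiag h x y = h x y.
Proof.
by move=> yx; rewrite /offdiag gtn_eqF// (maxn_idPl (ltnW yx)) (minn_idPr (ltnW yx)).
Qed.

Lemma offdiag_lt h x y : (y < x)%N -> offdiag h y x = h x y.
Proof. by move=> yx; rewrite offdiagC offdiag_gt. Qed.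

(** Comparison principle for the backward recursion, n being the number of steps still to go. The
    diagonal is absorbing and the pair is symmetric, so the one-step inequality has to be checked
    for N < M only. *)
Lemma pair_iter_le_offdiag f (h : nat -> nat -> nat -> R) :
  (forall x y, f x y <= offdiag (h 0%N) x y) ->
  (forall n M N, (N < M)%N -> pair_step (offdiag (h n)) M N <= h n.+1 M N) ->
  forall n x y, pair_iter n f x y <= offdiag (h n) x y.
Proof.
move=> h0 hS; elim=> [|n IH] x y //.
rewrite /pair_iter iterS -/(pair_iter n f).
apply: (@le_trans _ _ (pair_step (offdiag (h n)) x y)).
  by apply: pair_step_le.
have [yx|xy|->] := ltngtP y x.
- by rewrite offdiag_gt// hS.
- by rewrite offdiag_lt// pair_stepC ?hS//; exact: offdiagC.
- by rewrite pair_step_diag /offdiag ?eqxx.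
Qed.

End pair_chain.

(** * A supermartingale for the meeting time *)

Section potential.
Context {R : realType}.
Variables (p_ : nat -> R) (a th kap K pm : R) (i1 L1 : nat) (A : nat -> R).
Hypothesis p01 : forall i, 0 <= p_ i <= 1.
Hypothesis p0E : p_ 0%N = 1.
Hypotheses (th0 : 0 < th) (kap0 : 0 < kap) (aE : a = th + 2 * kap).
Hypotheses (i1_gt1 : (1 < i1)%N) (i1a : 4 * a <= i1%:R).
Hypothesis pE : forall M, (i1 <= M)%N -> p_ M = 1 - a / M%:R.
Hypothesis p_le : forall j M,
  (0 < j <= M)%N -> (i1 <= M)%N -> p_ j <= 1 - a / M%:R.
Hypothesis pm_le : forall j, (j < i1)%N -> pm <= p_ j.
Hypothesis A1 : forall M, (M <= i1)%N -> A M = 1.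
Hypothesis A_ge1 : forall M, 1 <= A M.
Hypothesis A_le : forall M, (i1 <= M)%N ->
  A M.+1 <= expR (kap / 8 / M%:R) * A M.
Hypothesis A_large : forall M, (L1 <= M)%N -> 4 * a / kap <= A M.
Hypotheses (K1 : 1 <= K) (KL1 : 8 * th * L1%:R <= kap * K)
  (Ka : 32 * a * th <= kap * K) (Kth : 2 * th <= K)
  (Ki1 : th * i1%:R ^+ 2 <= K * (a - kap))
  (Ki12 : 2 * th * i1%:R <= K)
  (Kpm : 4 * th * i1%:R ^+ 2 <= K * (pm * kap)).

(* [lra] does not look at section hypotheses. *)
Local Ltac plra := move: (th0) (kap0) (aE) (i1a) (K1) => ? ? ? ? ?; lra.

Definition decay (n M : nat) : R := ((M%:R + K) / (M%:R + K + n%:R)) `^ th.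

(** The maximum with [i1] makes the weight constant on the small states and keeps it at most 1
    everywhere. *)
Definition zero_weight (M : nat) : R := kap / (maxn M i1)%:R.

(* [N] and [M] are the smaller and the larger state.  The factor [A], constant
   from [L1] on, makes a return of [M] to 0 without meeting profitable: it lands
   at the pair [(0, 1)], where [A] is small.  The shift [K] is much larger than
   [L1], so that [decay] hardly varies in [M] while [A] is growing.  The weight
   at [N = 0] pays for the impossibility of meeting from there. *)
Definition potential (n M N : nat) : R :=
  (1 + (N == 0%N)%:R * zero_weight M) * A M * decay n M.

Let K0 : 0 < K. Proof. by apply: lt_le_trans K1. Qed.
Let a0 : 0 < a. Proof. by plra. Qed.

Lemma decay_ge0 n M : 0 <= decay n M.
Proof. exact: powR_ge0. Qed.

(** M rises by at least 1 while n drops by 1, so the denominator M' + K + n is at least M + K + n +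
    1 and only the ratio of the numerators counts. *)
Lemma decay_succ n M M' : (M < M')%N ->
  decay n M' <= expR (th * ((M'%:R - M%:R) / (M%:R + K))) * decay n.+1 M.
Proof.
move=> MM'; rewrite /decay.
have M0 : 0 <= M%:R :> R by []. have n0 : 0 <= n%:R :> R by [].
have MM'R : M%:R + 1 <= M'%:R :> R by rewrite natr1 ler_nat.
have d1 : 0 < M%:R + K by plra.
have d2 : 0 < M'%:R + K by plra.
have d3 : 0 < M%:R + K + n.+1%:R by rewrite -(natr1 n); plra.
have d4 : 0 < M'%:R + K + n%:R by plra.
have := @powR_ratio_le R _ _ th d1 d2 (ltW th0).
have -> : M'%:R + K - (M%:R + K) = M'%:R - M%:R by ring.
move=> h; apply: le_trans (ler_wpM2r (powR_ge0 _ _) h).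
rewrite -powRM ?divr_ge0 ?(ltW d1) ?(ltW d2) ?(ltW d3)//.
apply: (ge0_ler_powR (ltW th0));
  rewrite ?nnegrE ?mulr_ge0 ?invr_ge0 ?(ltW d1) ?(ltW d2) ?(ltW d3) ?(ltW d4)//.
rewrite mulrA divfK ?gt_eqF// ler_pM2l// lef_pV2 ?posrE//.
rewrite -(natr1 n); plra.
Qed.

Lemma decay_le n M M' : (M <= M')%N -> decay n M <= decay n M'.
Proof.
move=> MM'; rewrite /decay.
have M0 : 0 <= M%:R :> R by []. have n0 : 0 <= n%:R :> R by [].
have MM'R : M%:R <= M'%:R :> R by rewrite ler_nat.
have d1 : 0 < M%:R + K by plra.
have d2 : 0 < M'%:R + K by plra.
have d3 : 0 < M%:R + K + n%:R by plra.
have d4 : 0 < M'%:R + K + n%:R by plra.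
apply: (ge0_ler_powR (ltW th0));
  rewrite ?nnegrE ?mulr_ge0 ?invr_ge0 ?(ltW d1) ?(ltW d2) ?(ltW d3) ?(ltW d4)//.
rewrite ler_pdivrMr// mulrAC ler_pdivlMr//; nra.
Qed.

(** A large [K] makes [decay] flat below [i1], since (i1 - M) / (M + K) <= i1 / K. *)
Lemma decay_succ_le n M M' : (M < i1)%N -> (M' <= i1)%N ->
  decay n M' <= expR (th * i1%:R / K) * decay n.+1 M.
Proof.
move=> Mi M'i; apply: (le_trans (decay_le n M'i)).
apply: (le_trans (decay_succ n Mi)).
rewrite ler_wpM2r ?decay_ge0// ler_expR -mulrA ler_wpM2l ?(ltW th0)//.
have M0 : 0 <= M%:R :> R by [].
have : M%:R + 1 <= i1%:R :> R by rewrite natr1 ler_nat.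
move=> ?; rewrite ler_pdivrMr ?ltr_wpDl// mulrAC ler_pdivlMr//.
have := mulr_ge0 M0 (ltW K0); have : 0 <= i1%:R * M%:R :> R by rewrite mulr_ge0.
lra.
Qed.

Lemma zero_weight_le1 M : 0 < zero_weight M <= 1.
Proof.
have h : i1%:R <= (maxn M i1)%:R :> R by rewrite ler_nat leq_maxr.
have m0 : 0 < (maxn M i1)%:R :> R by plra.
rewrite /zero_weight divr_gt0//= ler_pdivrMr// mul1r; plra.
Qed.

Let p_M_exp M : (i1 <= M)%N -> 0 <= p_ M <= expR (- (a / M%:R)).
Proof.
move=> iM; have /andP[-> _] := p01 M; rewrite pE//=.
exact: expR_ge1Dx.
Qed.

Let i1_gt0 : 0 < i1%:R :> R.
Proof. by rewrite ltr0n; case: i1 i1_gt1. Qed.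

Let growth n M : (i1 <= M)%N ->
  A M.+1 * decay n M.+1 <= expR (kap / 8 / M%:R) * A M *
    (expR (th / (M%:R + K)) * decay n.+1 M).
Proof.
move=> iM; rewrite ler_pM ?decay_ge0 ?A_le//.
  by have := A_ge1 M.+1; plra.
have := @decay_succ n M M.+1 (ltnSn _).
by rewrite -(natr1 M) addrC addKr mul1r.
Qed.

(** As p_N <= p_M, a jump of M is also a jump of N, and the mass off the diagonal is exactly p_M.
    All of it is charged the weight 1 + g that applies when N falls to 0; the exponents then sum to
    less than 0 because a = th + 2 kap. *)
Lemma potential_step_large_pos n M N : (i1 <= M)%N -> (0 < N < M)%N ->
  pair_step p_ (offdiag (potential n)) M N <= potential n.+1 M N.
Proof.
move=> iM /andP[N0 NM].
have pNM : p_ N <= p_ M by rewrite (pE iM); apply: p_le; rewrite // N0 ltnW.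
rewrite /pair_step (min_idPr pNM) subrr mul0r addr0.
rewrite [offdiag _ 0%N 0%N]/offdiag eqxx mulr0 addr0.
rewrite !offdiag_gt// /potential (gtn_eqF N0) /= !mul0r !addr0 !mul1r.
have M0 : 0 < M%:R :> R by rewrite ltr0n (leq_trans _ iM)// ltnW.
set g := zero_weight M.+1; set X := A M.+1 * decay n M.+1.
have X0 : 0 <= X by rewrite mulr_ge0 ?decay_ge0//; have := A_ge1 M.+1; plra.
have g0 : 0 <= g by have /andP[/ltW] := zero_weight_le1 M.+1.
have /andP[pM0 pMe] := p_M_exp iM.
have pN0 : 0 <= p_ N by have /andP[] := p01 N.
apply: (@le_trans _ _ (p_ M * (1 + g) * X)).
  rewrite -(mulrA (1 + g)) -/X.
  by have := mulr_ge0 pN0 (mulr_ge0 g0 X0); lra.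
have hX := growth n iM; rewrite -/X in hX.
have hg : 1 + g <= expR (kap / M%:R).
  apply: (@le_trans _ _ (1 + kap / M%:R)); last exact: expR_ge1Dx.
  rewrite lerD2l /g /zero_weight ler_wpM2l ?(ltW kap0)//.
  have MM : M%:R <= (maxn M.+1 i1)%:R :> R by rewrite ler_nat leq_max leqnSn.
  by rewrite lef_pV2// posrE (lt_le_trans M0).
apply: (@le_trans _ _ (expR (- (a / M%:R)) * expR (kap / M%:R) *
   (expR (kap / 8 / M%:R) * A M * (expR (th / (M%:R + K)) * decay n.+1 M)))).
  by rewrite ler_pM// ?mulr_ge0 ?ler_pM//; plra.
have -> : expR (- (a / M%:R)) * expR (kap / M%:R) *
   (expR (kap / 8 / M%:R) * A M * (expR (th / (M%:R + K)) * decay n.+1 M)) =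
   expR (- (a / M%:R)) * expR (kap / M%:R) *
   expR (kap / 8 / M%:R) * expR (th / (M%:R + K)) * (A M * decay n.+1 M).
  ring.
rewrite -!expRD ler_piMl//.
  by rewrite mulr_ge0 ?decay_ge0//; have := A_ge1 M; plra.
rewrite -[leRHS]expR0 ler_expR.
have : th / (M%:R + K) <= th / M%:R.
  by rewrite ler_wpM2l ?(ltW th0)// lef_pV2 ?posrE ?ltr_wpDr//; plra.
have -> : - (a / M%:R) + kap / M%:R + kap / 8 / M%:R + th / (M%:R + K) =
   th / (M%:R + K) - th / M%:R - (7 / 8) * (kap / M%:R).
  by rewrite aE; field; rewrite !gt_eqF//; plra.
have : 0 < kap / M%:R by rewrite divr_gt0.
plra.
Qed.

Let g0 := kap / i1%:R.
Let g0_bounds : [/\ 0 < g0, g0 <= 1 & a * g0 <= kap / 4].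
Proof.
rewrite /g0; split; first by rewrite divr_gt0.
  by rewrite ler_pdivrMr//; plra.
rewrite mulrA ler_pdivrMr//.
have := ler_wpM2l (ltW kap0) i1a; lra.
Qed.

Let zero_weightE M : (M <= i1)%N -> zero_weight M = g0.
Proof. by move=> Mi; rewrite /zero_weight (maxn_idPr Mi). Qed.

(** Since p_0 = 1, the copy at 0 moves to 1 for sure, so neither exit lies on the diagonal. *)
Let pair_step_zero n M : (0 < M)%N ->
  pair_step p_ (offdiag (potential n)) M 0%N =
  p_ M * (A M.+1 * decay n M.+1) + (1 - p_ M) * ((1 + g0) * decay n 1).
Proof.
move=> M0; have /andP[_ pM1] := p01 M.
rewrite /pair_step p0E (min_idPl pM1) (max_idPr pM1) !subrr !mul0r !addr0.
rewrite offdiag_gt// offdiag_lt// /potential /= mul0r addr0 !mul1r.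
by rewrite (zero_weightE (ltnW i1_gt1)) (A1 (ltnW i1_gt1)) mulr1.
Qed.

(** The critical case: the surplus kap / M at (M, 0) has to cover the return to (0, 1), of
    probability a / M. The argument depends on whether [A] has already reached its final size. *)
Lemma potential_step_large_zero n M : (i1 <= M)%N ->
  pair_step p_ (offdiag (potential n)) M 0%N <= potential n.+1 M 0%N.
Proof.
move=> iM; have M0 : (0 < M)%N by rewrite (leq_trans _ iM)// ltnW.
have MR0 : 0 < M%:R :> R by rewrite ltr0n.
have iMR : i1%:R <= M%:R :> R by rewrite ler_nat.
rewrite pair_step_zero// /potential /= mul1r.
rewrite /zero_weight (maxn_idPl iM).
have hX := growth n iM.
set D := decay n.+1 M in hX *; set X := _ * decay n M.+1 in hX *.
have D0 : 0 <= D by exact: decay_ge0.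
set z : R := M%:R^-1; have z0 : 0 < z by rewrite invr_gt0.
have [g00 g01 ag0] := g0_bounds.
have AM1 := A_ge1 M.
have X0 : 0 <= X by rewrite mulr_ge0 ?decay_ge0//; have := A_ge1 M.+1; lra.
have /andP[pM0 _] := p01 M.
set v := th / K.
have v0 : 0 <= v by rewrite divr_ge0 ?ltW.
have v1 : v <= 1 / 2 by rewrite ler_pdivrMr//; move: (Kth); lra.
have av : a * v <= kap / 32.
  by rewrite mulrA ler_pdivrMr//; move: (Ka); lra.
have h1 : decay n 1 <= (1 + 2 * v) * D.
  apply: (le_trans (decay_le n M0)); apply: (le_trans (decay_le n (leqnSn M))).
  apply: (le_trans (decay_succ n (ltnSn M))).
  rewrite ler_wpM2r//.
  apply: le_trans (expR_le1D2x v0 v1); rewrite ler_expR.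
  rewrite -(natr1 M) addrC addKr mul1r ler_wpM2l ?(ltW th0)//.
  by rewrite lef_pV2 ?posrE ?ltr_wpDl// ler_wpDl.
have h2 : (1 - p_ M) * ((1 + g0) * decay n 1) <=
    (a * z) * ((1 + g0) * ((1 + 2 * v) * D)).
  rewrite (pE iM) subKr ler_wpM2l ?mulr_ge0 ?(ltW a0) ?(ltW z0)//.
  by rewrite ler_wpM2l//; lra.
have az0 : 0 <= a * z by rewrite mulr_ge0 ?ltW.
have h3 : (1 + g0) * (1 + 2 * v) <= 1 + g0 + 4 * v by nra.
(* From [L1] on, the surplus is worth kap / M times A M, at least 4 a / M, whereas the return is
   worth at most (a / M) (1 + g0) (1 + 2 v) because [A] is 1 at (0, 1). *)
have [LM|ML] := leqP L1 M.
  have pX : p_ M * X <= A M * D.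
    have /andP[_ pMe] := p_M_exp iM.
    apply: (le_trans (ler_pM pM0 X0 pMe hX)).
    have -> : expR (- (a / M%:R)) * (expR (kap / 8 / M%:R) * A M *
        (expR (th / (M%:R + K)) * D)) =
      expR (- (a / M%:R)) * expR (kap / 8 / M%:R) * expR (th / (M%:R + K)) *
      (A M * D) by ring.
    rewrite -!expRD ler_piMl//; first by rewrite mulr_ge0//; lra.
    rewrite -[leRHS]expR0 ler_expR.
    have : th / (M%:R + K) <= th * z.
      by rewrite ler_wpM2l ?(ltW th0)// lef_pV2 ?posrE; plra.
    have : 0 < kap * z by rewrite mulr_gt0.
    rewrite -/z [in a * z]aE; lra.
  have hA : 4 * a <= kap * A M.
    by have := A_large LM; rewrite ler_pdivrMr//; lra.
  apply: (le_trans (lerD pX h2)).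
  have -> : (1 + kap * z) * A M * D = A M * D + z * (kap * A M) * D by ring.
  rewrite lerD2l.
  have -> : a * z * ((1 + g0) * ((1 + 2 * v) * D)) =
    z * (a * ((1 + g0) * (1 + 2 * v))) * D by ring.
  rewrite ler_wpM2r// ler_wpM2l ?(ltW z0)//; apply: le_trans hA.
  by rewrite mulrC ler_wpM2r ?(ltW a0)//; lra.
(* Below [L1] only A M >= 1 is at hand, but M is small against [K], so th / (M + K) <= kap / (8 M).
   The terms in a / M of the two exits then cancel, and the errors 1 / 2 and 3 / 8 of kap / M fit
   into the surplus. *)
have pX : p_ M * X <= (1 - a * z + kap / 2 * z) * (A M * D).
  apply: (le_trans (ler_wpM2l pM0 hX)).
  have -> : p_ M * (expR (kap / 8 / M%:R) * A M *
        (expR (th / (M%:R + K)) * D)) =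
      p_ M * (expR (kap / 8 / M%:R) * expR (th / (M%:R + K))) *
      (A M * D) by ring.
  rewrite ler_wpM2r//; first by rewrite mulr_ge0//; lra.
  have MLR : M%:R <= L1%:R :> R by rewrite ler_nat ltnW.
  have y0 : 0 <= kap / 4 * z by rewrite mulr_ge0 ?(ltW z0)//; plra.
  have y1 : kap / 4 * z <= 1 / 2.
    by rewrite ler_pdivrMr//; plra.
  have : expR (kap / 8 / M%:R) * expR (th / (M%:R + K)) <= 1 + kap / 2 * z.
    have -> : 1 + kap / 2 * z = 1 + 2 * (kap / 4 * z) by field.
    apply: le_trans (expR_le1D2x y0 y1).
    rewrite -expRD ler_expR.
    have : th / (M%:R + K) <= kap / 8 * z.
      rewrite ler_pdivrMr ?ltr_wpDl// mulrAC ler_pdivlMr//.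
      have : th * M%:R <= th * L1%:R by rewrite ler_wpM2l ?(ltW th0).
      have : 0 <= kap * M%:R by rewrite mulr_ge0 ?ltW.
      by move: (KL1); lra.
    rewrite -/z; lra.
  set e := expR _ * _ => he.
  have pM1 : p_ M = 1 - a * z by rewrite (pE iM).
  have kz0 : 0 <= kap / 2 * z by lra.
  have := ler_wpM2l pM0 he; rewrite pM1.
  have := mulr_ge0 az0 kz0; lra.
apply: (le_trans (lerD pX h2)).
have -> : a * z * ((1 + g0) * ((1 + 2 * v) * D)) =
    a * z * ((1 + g0) * (1 + 2 * v)) * D by ring.
have h4 : a * z * ((1 + g0) * (1 + 2 * v)) <= (a * z + 3 / 8 * (kap * z)).
  apply: (le_trans (ler_wpM2l az0 h3)).
  have : z * (a * g0 + 4 * (a * v)) <= z * (3 / 8 * kap).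
    by rewrite ler_wpM2l ?(ltW z0)//; lra.
  lra.
have h5 : D <= A M * D by rewrite ler_peMl.
have kz0 : 0 <= kap * z by rewrite mulr_ge0 ?ltW.
have h6 : a * z * ((1 + g0) * (1 + 2 * v)) * D <=
    (a * z + 3 / 8 * (kap * z)) * (A M * D).
  have q0 : 0 <= (1 + g0) * (1 + 2 * v) by rewrite mulr_ge0//; lra.
  by apply: ler_pM => //; rewrite mulr_ge0.
apply: (le_trans (lerD (lexx _) h6)).
have := mulr_ge0 kz0 (le_trans D0 h5); lra.
Qed.

Let step_small n M x y : (M < i1)%N -> (maxn x y <= i1)%N ->
  offdiag (potential n) x y <=
  (if (x == 0%N) || (y == 0%N) then 1 + g0 else 1) *
  (expR (th * i1%:R / K) * decay n.+1 M).
Proof.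
move=> Mi xyi; have [g00 _ _] := g0_bounds.
have E0 : 0 <= expR (th * i1%:R / K) * decay n.+1 M.
  by rewrite mulr_ge0 ?expR_ge0 ?decay_ge0.
rewrite /offdiag; case: eqP => [_|xy].
  by rewrite mulr_ge0//; case: ifP => _; lra.
rewrite /potential (A1 xyi) mulr1 (zero_weightE xyi).
have -> : (minn x y == 0%N) = (x == 0%N) || (y == 0%N).
  by rewrite -!leqn0 geq_min.
apply: ler_pM; rewrite ?decay_ge0 ?(decay_succ_le n Mi xyi)//.
  by case: (_ || _) => /=; lra.
by case: (_ || _) => /=; lra.
Qed.

(** The order of p_M and p_N is unknown here. The pair stays off the diagonal with probability max
    (p_M, p_N) <= 1 - a / i1, and this loss outweighs both the weight 1 + g0 and the variation of
    [decay], which [K] makes at most exp ((a - kap) / i1). *)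
Lemma potential_step_small_pos n M N : (M < i1)%N -> (0 < N < M)%N ->
  pair_step p_ (offdiag (potential n)) M N <= potential n.+1 M N.
Proof.
move=> Mi /andP[N0 NM].
have M0 : (0 < M)%N by rewrite (leq_trans _ NM).
have [g00 g01 _] := g0_bounds.
set E := expR (th * i1%:R / K) * decay n.+1 M.
have E0 : 0 <= E by rewrite mulr_ge0 ?expR_ge0 ?decay_ge0.
apply: (@le_trans _ _ ((1 - a / i1%:R) * ((1 + g0) * E))).
  apply: (@le_trans _ _
    (pair_step p_ (fun x y => (~~ (x == y))%:R * ((1 + g0) * E)) M N)).
    have H x y : (maxn x y <= i1)%N ->
        offdiag (potential n) x y <= (~~ (x == y))%:R * ((1 + g0) * E).
      move=> xyi; have := step_small n Mi xyi; rewrite -/E.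
      have [->|xy] := eqVneq x y; first by rewrite /offdiag eqxx mul0r.
      move=> h; rewrite mul1r; apply: (le_trans h).
      by rewrite ler_wpM2r//; case: ifP => _; lra.
    apply: (pair_step_le p01); apply: H.
    - by rewrite geq_max Mi (ltn_trans NM Mi).
    - by rewrite geq_max Mi ltnW// (leq_trans _ Mi).
    - by rewrite geq_max /= (ltn_trans NM Mi).
    - by [].
  rewrite /pair_step eqSS (gtn_eqF NM) !eqxx /= !mul1r mul0r mulr0 addr0.
  set m := Num.min _ _.
  have -> : m * ((1 + g0) * E) + (p_ M - m) * ((1 + g0) * E) +
     (p_ N - m) * ((1 + g0) * E) = (p_ M + p_ N - m) * ((1 + g0) * E) by ring.
  rewrite ler_wpM2r//; first by rewrite mulr_ge0//; lra.
  have pM := @p_le M i1; have pN := @p_le N i1.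
  rewrite !leqnn M0 N0 (ltnW Mi) (ltnW (ltn_trans NM Mi)) in pM pN.
  move/(_ isT isT): pM => pM; move/(_ isT isT): pN => pN.
  by rewrite /m; case: (leP (p_ M) (p_ N)) => _; lra.
rewrite /potential (gtn_eqF N0) /= mul0r addr0 mul1r (A1 (ltnW Mi)) mul1r.
rewrite mulrA /E mulrA ler_piMl ?decay_ge0//.
apply: (@le_trans _ _ (expR (- (a / i1%:R)) * expR g0 *
    expR (th * i1%:R / K))).
  rewrite ler_wpM2r ?expR_ge0//.
  apply: (@le_trans _ _ (expR (- (a / i1%:R)) * (1 + g0))).
    by rewrite ler_wpM2r ?expR_ge1Dx//; lra.
  by rewrite ler_wpM2l ?expR_ge0 ?expR_ge1Dx.
rewrite -!expRD -[leRHS]expR0 ler_expR.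
have : th * i1%:R / K <= (a - kap) / i1%:R.
  by rewrite ler_pdivrMr// mulrAC ler_pdivlMr//; move: (Ki1); lra.
rewrite mulrBl -/g0; lra.
Qed.

(** Here the gain comes from the weight alone: 1 + g0 is dropped with probability p_M >= pm and kept
    at (0, 1). The gain pm * g0 exceeds the variation of [decay], of order th * i1 / K. *)
Lemma potential_step_small_zero n M : (0 < M < i1)%N ->
  pair_step p_ (offdiag (potential n)) M 0%N <= potential n.+1 M 0%N.
Proof.
move=> /andP[M0 Mi]; have [g00 g01 _] := g0_bounds.
rewrite pair_step_zero// /potential /= mul1r.
rewrite (zero_weightE (ltnW Mi)) (A1 Mi) (A1 (ltnW Mi)) mul1r mulr1.
set v := th * i1%:R / K.
have v0 : 0 <= v by rewrite divr_ge0 ?mulr_ge0 ?ltW.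
have v1 : v <= 1 / 2 by rewrite ler_pdivrMr//; move: (Ki12); lra.
have ev : expR v <= 1 + 2 * v := expR_le1D2x v0 v1.
set D := decay n.+1 M; have D0 : 0 <= D by exact: decay_ge0.
have d1 : decay n M.+1 <= (1 + 2 * v) * D.
  by apply: (le_trans (decay_succ_le n Mi Mi)); rewrite ler_wpM2r.
have d2 : decay n 1 <= (1 + 2 * v) * D.
  apply: (le_trans (decay_succ_le n Mi (ltnW i1_gt1))).
  by rewrite ler_wpM2r.
have /andP[pM0 pM1] := p01 M.
apply: (@le_trans _ _ (p_ M * ((1 + 2 * v) * D) +
    (1 - p_ M) * ((1 + g0) * ((1 + 2 * v) * D)))).
  apply: lerD; first by rewrite ler_wpM2l.
  by rewrite ler_wpM2l ?ler_wpM2l//; lra.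
have -> : p_ M * ((1 + 2 * v) * D) +
    (1 - p_ M) * ((1 + g0) * ((1 + 2 * v) * D)) =
    ((1 + 2 * v) * (1 + g0 - p_ M * g0)) * D by ring.
rewrite ler_wpM2r//.
have h : 4 * v <= pm * g0.
  have -> : 4 * v = 4 * th * i1%:R / K by rewrite /v; ring.
  rewrite ler_pdivrMr//.
  have -> : pm * g0 * K = K * (pm * kap) / i1%:R by rewrite /g0; ring.
  rewrite ler_pdivlMr//.
  by move: (Kpm); lra.
have := pm_le Mi => pmM.
have : pm * g0 <= p_ M * g0 by rewrite ler_wpM2r// ltW.
have := mulr_ge0 v0 (ltW g00).
have : 0 <= v * (1 - g0) by rewrite mulr_ge0//; lra.
have := mulr_ge0 v0 (mulr_ge0 pM0 (ltW g00)).
lra.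
Qed.

Lemma potential_step n M N : (N < M)%N ->
  pair_step p_ (offdiag (potential n)) M N <= potential n.+1 M N.
Proof.
move=> NM; case: N NM => [|N] NM; case: (leqP i1 M) => iM.
- exact: potential_step_large_zero.
- by apply: potential_step_small_zero; rewrite NM.
- by apply: potential_step_large_pos; rewrite ?NM.
- by apply: potential_step_small_pos; rewrite ?NM.
Qed.

Lemma potential_ge1 M N : 1 <= potential 0 M N.
Proof.
rewrite /potential /decay addr0 divff; last by rewrite gt_eqF// ltr_wpDl.
rewrite powR1 mulr1.
have := A_ge1 M; have /andP[z0 _] := zero_weight_le1 M.
have : 1 <= 1 + (N == 0%N)%:R * zero_weight M.
  by rewrite lerDl mulr_ge0// ltW.
move=> h1 h2; rewrite -[leLHS]mulr1; apply: ler_pM => //; lra.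
Qed.

End potential.

(** * Choice of the constants and the tail of the meeting time *)

Section meeting_time_tail.
Context {R : realType}.
Implicit Types a th kap pm : R.

Lemma finite_positive_lbound (f : nat -> R) n :
  (forall j, (j < n)%N -> 0 < f j) ->
  exists2 d, 0 < d & forall j, (j < n)%N -> d <= f j.
Proof.
elim: n => [|n IH] fP; first by exists 1.
have [|d d0 dP] := IH; first by move=> j jn; exact/fP/ltnW.
exists (Num.min d (f n)) => [|j]; first by rewrite lt_min d0 fP.
rewrite ltnS leq_eqVlt ge_min => /orP[/eqP->|/dP->//].
by rewrite lexx orbT.
Qed.

Lemma exists_natr_ge (x : R) : exists n : nat, x <= n%:R.
Proof.
exists (Num.bound `|x|); apply: le_trans (ler_norm x) _.
by apply/ltW/archi_boundP.
Qed.

(** Every condition is a lower bound on [K], so the sum of the separate bounds satisfies them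
    all. *)
Lemma exists_large_shift a th kap pm (i1 L1 : nat) :
  0 < th -> 0 < kap -> a = th + 2 * kap -> 0 < pm ->
  exists K, [/\ 1 <= K, 8 * th * L1%:R <= kap * K, 32 * a * th <= kap * K,
    2 * th <= K & [/\ th * i1%:R ^+ 2 <= K * (a - kap),
    2 * th * i1%:R <= K & 4 * th * i1%:R ^+ 2 <= K * (pm * kap)]].
Proof.
move=> th0 kap0 aE pm0.
have H (x y : R) : 0 <= x -> 0 < y ->
    exists2 t, 0 <= t & x = t * y.
  move=> x0 y0; exists (x / y); first by rewrite divr_ge0// ltW.
  by rewrite divfK// gt_eqF.
have i0 : 0 <= i1%:R :> R by [].
have L0 : 0 <= L1%:R :> R by [].
have i20 : 0 <= i1%:R ^+ 2 :> R by rewrite exprn_ge0.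
have [t1 t10 E1] := H (8 * th * L1%:R) kap ltac:(nra) kap0.
have [t2 t20 E2] := H (32 * a * th) kap ltac:(nra) kap0.
have [t3 t30 E3] := H (th * i1%:R ^+ 2) (a - kap) ltac:(nra) ltac:(lra).
have pk : 0 < pm * kap by rewrite mulr_gt0.
have [t4 t40 E4] := H (4 * th * i1%:R ^+ 2) (pm * kap) ltac:(nra) pk.
pose s := 1 + 2 * th + 2 * th * i1%:R.
have s1 : 1 <= s by rewrite /s; nra.
exists (s + t1 + t2 + t3 + t4).
rewrite E1 E2 E3 E4 (mulrC kap); split.
- lra.
- by rewrite ler_wpM2r ?(ltW kap0)//; lra.
- by rewrite ler_wpM2r ?(ltW kap0)//; lra.
- rewrite /s; nra.
- split; first by rewrite ler_wpM2r//; lra.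
  + by rewrite /s; lra.
  + by rewrite ler_wpM2r ?(ltW pk)//; lra.
Qed.

(** The power kap / 8 of this ratio serves as the factor [A] of [potential]: its relative growth per
    step is then at most about kap / (8 M). *)
Definition clamp_ratio (i1 L1 M : nat) : R := (minn (maxn M i1) L1)%:R / i1%:R.

Lemma clamp_ratio_props (i1 L1 : nat) kap : (0 < i1 <= L1)%N -> 0 < kap ->
  let A M := clamp_ratio i1 L1 M `^ kap in
  [/\ forall M, (M <= i1)%N -> A M = 1,
      forall M, 1 <= A M <= (L1%:R / i1%:R) `^ kap,
      forall M, (i1 <= M)%N -> A M.+1 <= expR (kap / M%:R) * A M &
      forall M, (L1 <= M)%N -> A M = (L1%:R / i1%:R) `^ kap].
Proof.
move=> /andP[i10 iL] kap0 /=; rewrite /clamp_ratio.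
have iR : 0 < i1%:R :> R by rewrite ltr0n.
split.
- move=> M Mi; rewrite (maxn_idPr Mi) (minn_idPl iL) divff ?powR1//.
  by rewrite gt_eqF.
- move=> M; set m := minn _ _.
  have mi : i1%:R <= m%:R :> R by rewrite ler_nat leq_min iL leq_maxr.
  have mL : m%:R <= L1%:R :> R by rewrite ler_nat geq_minr.
  apply/andP; split.
    apply: (@le_trans _ _ (1 `^ kap)); first by rewrite powR1.
    apply: (ge0_ler_powR (ltW kap0)).
    + by rewrite nnegrE.
    + by rewrite nnegrE divr_ge0.
    + by rewrite ler_pdivlMr ?mul1r.
  apply: (ge0_ler_powR (ltW kap0)); rewrite ?nnegrE ?divr_ge0//.
  by rewrite ler_wpM2r// invr_ge0 ltW.
- move=> M iM; have M0 : 0 < M%:R :> R by rewrite ltr0n (leq_trans i10).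
  rewrite (maxn_idPl iM) (maxn_idPl (leqW iM)).
  have [LM|ML] := leqP L1 M.
        rewrite (minn_idPr (leqW LM)) ler_peMl ?powR_ge0//.
    by rewrite -[leLHS]expR0 ler_expR divr_ge0// ltW.
  rewrite (minn_idPl ML).
  have MS0 : 0 < M.+1%:R :> R by [].
  have := powR_ratio_le M0 MS0 (ltW kap0).
  rewrite -{2}(natr1 M) addrC addKr mul1r => h.
  apply: le_trans (ler_wpM2r (powR_ge0 _ _) h).
  rewrite -powRM ?divr_ge0//.
  by rewrite mulrA divfK// gt_eqF.
- move=> M LM; congr ((_%:R / _) `^ _).
  by apply/minn_idPr; rewrite leq_max LM.
Qed.

(** The constants are chosen in the order [kap], [i1], [pm], [L1], [K], each depending on the
    earlier ones only; [n] and the starting pair enter after all of them. *)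
Theorem pair_meeting_tail (p_ : nat -> R) (i0 : nat) a th :
  (forall i, 0 < p_ i) -> p_ 0%N = 1 -> (forall i, (0 < i)%N -> p_ i < 1) ->
  (forall i, (i0 <= i)%N -> p_ i = 1 - a / i%:R) ->
  0 < th -> th < a ->
  exists2 C, 0 < C & forall n x y,
    pair_iter p_ n (fun x y => (x != y)%:R) x y <=
    C * ((maxn x y).+1%:R / ((maxn x y).+1%:R + n%:R)) `^ th.
Proof.
move=> p0 p0E p1 pE th0 tha.
have p01 i : 0 <= p_ i <= 1.
  by rewrite ltW//=; case: i => [|i]; [rewrite p0E|exact/ltW/p1].
pose kap := (a - th) / 2.
have kap0 : 0 < kap by rewrite /kap; lra.
have aE : a = th + 2 * kap by rewrite /kap; lra.
have a0 : 0 < a by lra.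
(* [d] separates the finitely many p_j with 0 < j < i0 from 1; the value 1 at j = 0 is a dummy. With
   i1 >= a / d this yields p_j <= 1 - a / M for M >= i1, although p_ need not be monotone. *)
have [d d0 dP] : exists2 d, 0 < d & forall j, (j < i0)%N ->
    d <= if j == 0%N then 1 else 1 - p_ j.
  apply: finite_positive_lbound => j _; case: eqP => // /eqP.
  by rewrite -lt0n => /p1; lra.
have [n1 n1P] := exists_natr_ge (4 * a).
have [n2 n2P] := exists_natr_ge (a / d).
pose i1 := (maxn i0 2 + n1 + n2)%N.
have i1_gt1 : (1 < i1)%N.
  by rewrite /i1 -!addnA (leq_trans _ (leq_addr _ _))// leq_maxr.
have i0i1 : (i0 <= i1)%N.
  by rewrite /i1 -!addnA (leq_trans _ (leq_addr _ _))// leq_maxl.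
have i1R : i1%:R = (maxn i0 2)%:R + n1%:R + n2%:R :> R by rewrite /i1 !natrD.
have m0 : 0 <= (maxn i0 2)%:R :> R by [].
have n10 : 0 <= n1%:R :> R by [].
have n20 : 0 <= n2%:R :> R by [].
have i1a : 4 * a <= i1%:R by lra.
have i1d : a / d <= i1%:R by lra.
have pE1 M : (i1 <= M)%N -> p_ M = 1 - a / M%:R.
  by move=> iM; apply: pE; exact: leq_trans iM.
have p_le j M : (0 < j <= M)%N -> (i1 <= M)%N -> p_ j <= 1 - a / M%:R.
  move=> /andP[j0 jM] iM.
  have MR : i1%:R <= M%:R :> R by rewrite ler_nat.
  have M0 : 0 < M%:R :> R by rewrite ltr0n (leq_trans j0).
  have [ij|ji] := leqP i0 j.
    rewrite (pE _ ij) lerD2l lerN2 ler_wpM2l ?(ltW a0)//.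
    by rewrite lef_pV2 ?ler_nat// posrE ?ltr0n// (leq_trans j0).
  have := dP _ ji; rewrite gtn_eqF//.
  suff : a / M%:R <= d by lra.
  rewrite ler_pdivrMr// mulrC -ler_pdivrMr//; lra.
have [pm pm0 pmP] : exists2 pm, 0 < pm & forall j, (j < i1)%N -> pm <= p_ j.
  by apply: finite_positive_lbound => j _; exact: p0.
(* This size of [L1] makes (L1 / i1) ^ (kap / 8) reach 4 a / kap. *)
have [n3 n3P] := exists_natr_ge (i1%:R * (4 * a / kap) `^ (8 / kap)).
pose L1 := (i1 + n3)%N.
have iL : (0 < i1 <= L1)%N by rewrite (ltnW i1_gt1) leq_addr.
have k80 : 0 < kap / 8 by lra.
have i1R0 : 0 < i1%:R :> R by lra.
have [A1 A2 A3 A4] := clamp_ratio_props iL k80.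
set A := fun M => clamp_ratio i1 L1 M `^ (kap / 8) in A1 A2 A3 A4.
set B := (_ / _) `^ _ in A2 A4.
have A_large M : (L1 <= M)%N -> 4 * a / kap <= A M.
  move=> LM; rewrite /A A4// /B.
  have c0 : 0 <= 4 * a / kap by rewrite divr_ge0//; lra.
  have -> : 4 * a / kap = ((4 * a / kap) `^ (8 / kap)) `^ (kap / 8).
    rewrite -powRrM.
    have -> : 8 / kap * (kap / 8) = 1 by field; rewrite gt_eqF.
    by rewrite powRr1.
  apply: (ge0_ler_powR (ltW k80)).
  - by rewrite nnegrE powR_ge0.
  - by rewrite nnegrE divr_ge0.
  - rewrite ler_pdivlMr// mulrC; apply: (le_trans n3P).
    by rewrite ler_nat leq_addl.
have [K [K1 KL1 Ka Kth [Ki1 Ki12 Kpm]]] :=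
  exists_large_shift i1 L1 th0 kap0 aE pm0.
have A_ge1 M : 1 <= A M by have /andP[] := A2 M.
have B1 : 1 <= B by have /andP[h1 h2] := A2 0%N; exact: le_trans h2.
have K0 : 0 < K by lra.
have B0 : 0 < B by exact: lt_le_trans B1.
(* 2 bounds the weight at N = 0, [B] bounds [A], and K ^ th replaces the shift [K] by 1 through M +
   K <= K (M + 1). *)
exists (2 * B * K `^ th); first by rewrite (mulr_gt0 (mulr_gt0 _ B0)) ?powR_gt0.
move=> n x y.
apply: (@le_trans _ _ (offdiag (potential th kap K i1 A n) x y)).
  apply: (pair_iter_le_offdiag p01) => [{}x {}y|{}n M N NM].
    rewrite /offdiag; case: eqP => //= _.
    exact: (potential_ge1 th0 kap0 aE i1a A_ge1 K1).
  exact: (potential_step p01 p0E th0 kap0 aE i1_gt1 i1a pE1 p_le pmP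
    A1 A_ge1 A3 A_large K1 KL1 Ka Kth Ki1 Ki12 Kpm n NM).
rewrite /offdiag; case: eqP => [_|_].
  by rewrite !mulr_ge0 ?powR_ge0 ?(ltW B0).
set M := maxn x y; rewrite /potential.
have /andP[z0 z1] := zero_weight_le1 th0 kap0 aE i1a K1 M.
have /andP[_ AB] := A2 M.
have M0 : 0 <= M%:R :> R by [].
have n0 : 0 <= n%:R :> R by [].
have w0 : 0 <= 1 + (minn x y == 0%N)%:R * zero_weight kap i1 M <= 2.
  by case: (_ == _) => /=; lra.
have /andP[w1 w2] := w0; have AM := A_ge1 M.
have wA0 : 0 <= (1 + (minn x y == 0%N)%:R * zero_weight kap i1 M) * A M.
  by rewrite mulr_ge0//; lra.
rewrite -[leRHS]mulrA; apply: ler_pM; rewrite ?decay_ge0//.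
  by apply: ler_pM => //; lra.
rewrite /decay -powRM ?(ltW K0) ?divr_ge0//.
have KM : M%:R + K <= K * (M%:R + 1).
  by have := mulr_ge0 (_ : 0 <= K - 1) M0; rewrite subr_ge0 => /(_ K1); lra.
have MK0 : 0 <= M%:R + K by rewrite addr_ge0// ltW.
have M1n : 0 < M%:R + 1 + n%:R :> R by lra.
have MKn : M%:R + 1 + n%:R <= M%:R + K + n%:R by rewrite lerD2r lerD2l.
have MKn0 : 0 < M%:R + K + n%:R := lt_le_trans M1n MKn.
rewrite -(natr1 M) mulrA.
apply: (ge0_ler_powR (ltW th0)).
- by rewrite nnegrE divr_ge0// ltW.
- by rewrite nnegrE divr_ge0 ?(ltW M1n)// (le_trans MK0).
- by apply: ler_pM; rewrite ?invr_ge0 ?(ltW MKn0)// lef_pV2.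
Qed.

End meeting_time_tail.

(** * The rate function *)

Section rate_closed_form.
Context {R : realType}.
Variable th : R.
Hypothesis th1 : 1 < th.

Let th_gt0 : 0 < th. Proof. exact: lt_trans th1. Qed.

Lemma PhiE (t : R) : 1 <= t -> Phi th t = th * (t `^ th^-1 - 1).
Proof.
rewrite le_eqVlt => /predU1P[<-|t1].
  by rewrite /Phi set_itv1 Rintegral_set1 powR1 subrr mulr0.
have cvx (g : R -> R) (x : R) : derivable g x 1 -> g @ x --> g x.
  by move=> /derivable1_diffP/differentiable_continuous.
have dF (x : R) : 0 < x -> is_derive x 1 (fun s => th * s `^ th^-1) (x `^ (th^-1 - 1)).
  move=> x0; have -> : x `^ (th^-1 - 1) = th *: (th^-1 * x `^ (th^-1 - 1)).
    by rewrite /GRing.scale/= mulrA divff ?mul1r// gt_eqF.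
  exact: (is_deriveZ th (is_derive1_powR th^-1 x0)).
have phiE s : (phi th s)^-1 = s `^ (th^-1 - 1).
  by rewrite /phi -powRN opprB mul1r.
rewrite /Phi (_ : (fun s => (phi th s)^-1) = (fun s => s `^ (th^-1 - 1))).
  2: exact/funext.
rewrite /Rintegral.
rewrite (@continuous_FTC2 _ _ (fun s => th * s `^ th^-1))//=.
- by rewrite powR1 mulr1 mulrBr mulr1.
- apply/continuous_in_subspaceT => x /set_mem/=; rewrite in_itv/= => /andP[x1 _].
  apply: (cvx (fun s => s `^ (th^-1 - 1))).
  by apply: derivable_powR; rewrite in_itv/= andbT (lt_le_trans _ x1).
- split.
  + move=> x; rewrite in_itv/= => /andP[x1 _].
    by have [] := dF x (lt_trans ltr01 x1).
  + by apply: cvg_at_right_filter; apply: cvx; have [] := dF 1 ltr01.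
  + apply: cvg_at_left_filter; apply: cvx.
    by have [] := dF t (lt_trans ltr01 t1).
- move=> x; rewrite in_itv/= => /andP[x1 _]; rewrite derive1E.
  by have [_ ->] := dF x (lt_trans ltr01 x1).
Qed.

(** (1 + t / th) ^ th is the preimage of t under [Phi], which is injective on [1, +oo[. Hence the
    weights built from r(k) are bounded by powers of 1 + k. *)
Lemma rateE (t : R) : 0 <= t -> rate th t = (1 + t / th) `^ (th - 1).
Proof.
move=> t0; have tth0 : 0 <= t / th by rewrite divr_ge0// ltW.
set x := (1 + t / th) `^ th.
have x1 : 1 <= x.
  apply: (@le_trans _ _ (1 `^ th)); first by rewrite powR1.
  by apply: (ge0_ler_powR (ltW th_gt0)); rewrite ?nnegrE ?addr_ge0// lerDl.
have PhiI : {in `[1, +oo[%classic &, injective (Phi th)}.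
  move=> u v /set_mem/= + /set_mem/=; rewrite !in_itv/= !andbT => u1 v1.
  rewrite !PhiE// => /(mulfI (lt0r_neq0 th_gt0))/addIr h.
  have : (u `^ th^-1) `^ th = (v `^ th^-1) `^ th by rewrite h.
  by rewrite -!powRrM mulVf ?gt_eqF// !powRr1// (le_trans ler01).
have tE : t = Phi th x.
  rewrite PhiE// /x -powRrM divff ?gt_eqF// powRr1 ?addr_ge0//.
  by rewrite addrAC subrr add0r mulrC divfK// gt_eqF.
rewrite /rate {1}tE pinvKV//; last first.
  by apply/mem_set; rewrite /= in_itv/= x1.
rewrite /phi /x -powRrM; congr (_ `^ _); field; by rewrite gt_eqF.
Qed.

End rate_closed_form.

(** * Laws and couplings *)

Section esum_extra.
Context {R : realType}.
Local Open Scope ereal_scope.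

Lemma ge0_esumZl (T : choiceType) (I : set T) (a : T -> \bar R) (c : R) :
  (0 <= c)%R -> (forall i, 0 <= a i) ->
  \esum_(i in I) (c%:E * a i) = c%:E * \esum_(i in I) a i.
Proof.
move=> c0 a0; rewrite /esum -ereal_supZl//; last first.
  by apply/set0P; exists (\sum_(i \in set0) a i); exists set0 => //; exact: fsets_set0.
congr ereal_sup; apply/seteqP; split => x /=.
  move=> [F FI <-]; exists (\sum_(i \in F) a i); first by exists F.
  by rewrite ge0_mule_fsumr.
move=> [_ [F FI <-] <-]; exists F => //.
by rewrite ge0_mule_fsumr.
Qed.

Lemma esum_exchange (T1 T2 : choiceType) (a : T1 -> T2 -> \bar R) :
  (forall i j, 0 <= a i j) ->
  \esum_(i in [set: T1]) \esum_(j in [set: T2]) a i j =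
  \esum_(j in [set: T2]) \esum_(i in [set: T1]) a i j.
Proof.
move=> a0; rewrite !esum_esum//.
rewrite (reindex_esum ([set: T2] `*`` fun=> [set: T1]) _ (fun z => (z.2, z.1)))//.
split => //.
- by move=> [x y] [u v] _ _ /= [-> ->].
- by move=> [x y] _; exists (y, x).
Qed.

End esum_extra.

Section chain_laws.
Context {R : realType}.
Variable p_ : nat -> R.
Hypothesis p01 : forall i, (0 <= p_ i <= 1)%R.
Local Open Scope ereal_scope.

Let p0 i : 0 <= (p_ i)%:E. Proof. by rewrite lee_fin; case/andP: (p01 i). Qed.
Let q0 i : 0 <= (1 - p_ i)%:E.
Proof. by rewrite lee_fin subr_ge0; case/andP: (p01 i). Qed.

Lemma brt_law_lastE i k A :
  brt_law p_ i k.+1 A = \sum_(0 <= x <oo) brt_kernel p_ x A * brt_law p_ i k [set x].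
Proof.
rewrite -[LHS]/(\int[kernel_iter (brt_kernel p_) k i]_x brt_kernel p_ x A).
by rewrite ge0_integral_nat.
Qed.

(** Conditioning on the first step, whereas [kernel_iter] is built from the last one. The pair
    recurses on its starting point, so its marginals are identified in this form. *)
Lemma brt_lawS i k A : brt_law p_ i k.+1 A =
  (p_ i)%:E * brt_law p_ i.+1 k A + (1 - p_ i)%:E * brt_law p_ 0%N k A.
Proof.
elim: k A => [|k IH] A.
  rewrite -[LHS]/(\int[\d_i]_x brt_kernel p_ x A) integral_dirac//.
  by rewrite diracT mul1e brt_kernelE.
rewrite brt_law_lastE (eq_eseriesr (g := fun x =>
  (p_ i)%:E * (brt_kernel p_ x A * brt_law p_ i.+1 k [set x]) +
  (1 - p_ i)%:E * (brt_kernel p_ x A * brt_law p_ 0%N k [set x]))).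
  rewrite nneseriesD; last 2 first.
  - by move=> x _ _; rewrite !mule_ge0.
  - by move=> x _ _; rewrite !mule_ge0.
  by rewrite !nneseriesZl ?brt_law_lastE// => x _; rewrite mule_ge0.
move=> x _; rewrite IH ge0_muleDr ?mule_ge0//.
by rewrite !muleA; congr (_ * _ + _ * _); rewrite muleC.
Qed.

Lemma brt_lawT i k : brt_law p_ i k setT = 1.
Proof.
elim: k i => [|k IH] i; first by rewrite -[LHS]/(\d_i setT) diracT.
by rewrite brt_lawS !IH !mule1 -EFinD addrC subrK.
Qed.

Lemma brt_law_fin i k A : measurable A -> brt_law p_ i k A \is a fin_num.
Proof.
move=> mA; rewrite ge0_fin_numE//; apply: (@le_lt_trans _ _ 1); last by rewrite ltry.
by rewrite -(brt_lawT i k) le_measure ?inE.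
Qed.

Lemma brt_law_support i k A : (forall x, (x <= i + k)%N -> ~ A x) ->
  brt_law p_ i k A = 0.
Proof.
elim: k i => [|k IH] i Ai.
  rewrite -[LHS]/(\d_i A) diracE memNset//; apply: Ai; exact: leq_addr.
rewrite brt_lawS !IH ?mule0 ?adde0// => x xk; apply: Ai.
  by rewrite (leq_trans xk)//; lia.
by rewrite addSnnS in xk *.
Qed.

(** Invariance is iterated through the last step, with an exchange of sums. The case k = 0, A = setT
    also shows that the atoms of [pi] sum to 1. *)
Lemma brt_law_invariant (pi : probability nat R) :
  invariant_measure (brt_kernel p_) pi ->
  forall k A, \sum_(0 <= y <oo) brt_law p_ y k A * pi [set y] = pi A.
Proof.
move=> piP; elim=> [|k IH] A.
  rewrite -ge0_integral_nat; last by move=> y; exact: measure_ge0.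
  rewrite (eq_integral (fun y => (\1_A y)%:E)); last first.
    by move=> y _; rewrite -[LHS]/(\d_y A) diracE indicE.
  by rewrite integral_indic ?setIT.
have piE y : pi [set y] = (fine (pi [set y]))%:E.
  by rewrite fineK// fin_num_measure.
have KE x : brt_kernel p_ x A = (fine (brt_kernel p_ x A))%:E.
  by rewrite fineK// brt_kernelE// !diracE.
have fine_ge0_pi y : (0 <= fine (pi [set y]))%R by rewrite fine_ge0.
transitivity (\sum_(0 <= y <oo) \sum_(0 <= x <oo)
    brt_kernel p_ x A * (brt_law p_ y k [set x] * pi [set y])).
  apply: eq_eseriesr => y _; rewrite brt_law_lastE muleC piE -nneseriesZl.
    by apply: eq_eseriesr => x _; rewrite muleCA; congr (_ * _); rewrite muleC.
  by move=> x _; rewrite mule_ge0.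
rewrite nneseries_interchange; last by move=> *; rewrite !mule_ge0.
transitivity (\sum_(0 <= x <oo) brt_kernel p_ x A * pi [set x]).
  apply: eq_eseriesr => x _; rewrite -IH KE -nneseriesZl// => y _.
  by rewrite mule_ge0.
by rewrite -ge0_integral_nat//; exact: piP.
Qed.

End chain_laws.

Section wasserstein_coupling.
Context {R : realType}.
Local Open Scope ereal_scope.

Lemma wasserstein_le_cost (p : R) (mu nu : {measure set nat -> \bar R})
    (Pi : {measure set (nat * nat)%type -> \bar R}) : Pi setT = 1 ->
  (forall A, Pi (fst @^-1` A) = mu A) -> (forall A, Pi (snd @^-1` A) = nu A) ->
  wasserstein p mu nu <= (\esum_(z in [set: nat * nat])
      ((`|z.1%:R - z.2%:R| `^ p)%:E * Pi [set z])) `^ p^-1.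
Proof.
move=> Pi1 Pif Pis; pose Q : probability (nat * nat)%type R :=
  mnormalize Pi (\d_(0%N, 0%N) : probability _ R).
have QE A : Q A = Pi A.
  by rewrite /Q /= /mnormalize Pi1 /= onee_eq0 /= invr1 mule1.
apply: ereal_inf_lbound; exists Q.
  by split=> A; rewrite /pushforward QE.
by congr (_ `^ _); apply: eq_esum => z _; rewrite QE.
Qed.

End wasserstein_coupling.

Section pair_law.
Context {R : realType}.
Variable p_ : nat -> R.
Hypothesis p01 : forall i, (0 <= p_ i <= 1)%R.
Local Open Scope ereal_scope.

(* The absolute values only make the four weights of [pair_step]
   nonnegative by typing. *)
Fixpoint pair_law (n x y : nat) : {measure set (nat * nat)%type -> \bar R} :=
  if n is n'.+1 then
    let m := Num.min (p_ x) (p_ y) in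
    measure_add
      (measure_add (mscale (`|m|%:nng)%R (pair_law n' x.+1 y.+1))
                   (mscale (`|p_ x - m|%:nng)%R (pair_law n' x.+1 0%N)))
      (measure_add (mscale (`|p_ y - m|%:nng)%R (pair_law n' 0%N y.+1))
                   (mscale (`|1 - Num.max (p_ x) (p_ y)|%:nng)%R
                      (pair_law n' 0%N 0%N)))
  else \d_(x, y).

Let weights x y : let m := Num.min (p_ x) (p_ y) in
  [/\ (0 <= m)%R, (0 <= p_ x - m)%R, (0 <= p_ y - m)%R &
      (0 <= 1 - Num.max (p_ x) (p_ y))%R].
Proof.
have /andP[px0 px1] := p01 x; have /andP[py0 py1] := p01 y.
by rewrite /= !subr_ge0 le_min ge_max !ge_min px0 py0 px1 py1 !lexx orbT.
Qed.

Lemma pair_lawS n x y A : pair_law n.+1 x y A =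
  (Num.min (p_ x) (p_ y))%:E * pair_law n x.+1 y.+1 A
  + (p_ x - Num.min (p_ x) (p_ y))%:E * pair_law n x.+1 0%N A
  + (p_ y - Num.min (p_ x) (p_ y))%:E * pair_law n 0%N y.+1 A
  + (1 - Num.max (p_ x) (p_ y))%:E * pair_law n 0%N 0%N A.
Proof.
have [w1 w2 w3 w4] := weights x y.
rewrite /= /msum 2!big_ord_recl big_ord0 adde0 /= /msum.
rewrite !big_ord_recl !big_ord0 !adde0 /= /mscale /=.
by rewrite !ger0_norm// addeA.
Qed.

(** Duality between the two descriptions of the pair: couplings are measures, while the
    supermartingale argument is about the operator. *)
Lemma pair_law_esum n x y (f : nat -> nat -> R) : (forall x y, (0 <= f x y)%R) ->
  \esum_(z in [set: nat * nat]) ((f z.1 z.2)%:E * pair_law n x y [set z])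
  = (pair_iter p_ n f x y)%:E.
Proof.
move=> f0; elim: n x y => [|n IH] x y.
  rewrite -[RHS](@esum_set1 R _ (x, y) (fun z => (f z.1 z.2)%:E)) ?lee_fin//.
  rewrite [RHS]esum_mkcond; apply: eq_esum => z _ /=.
  rewrite diracE; case: (boolP ((x, y) \in [set z])).
    by move=> /set_mem/= <-; rewrite mule1 mem_set.
  move=> h; rewrite mule0 memNset// => zE; apply: (negP h).
  by apply/mem_set; rewrite /= zE.
have [w1 w2 w3 w4] := weights x y.
have fP (z : nat * nat) n' x' y' : 0 <= (f z.1 z.2)%:E * pair_law n' x' y' [set z].
  by rewrite mule_ge0 ?lee_fin.
transitivity (\esum_(z in [set: nat * nat])
  ((Num.min (p_ x) (p_ y))%:E * ((f z.1 z.2)%:E * pair_law n x.+1 y.+1 [set z])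
  + (p_ x - Num.min (p_ x) (p_ y))%:E * ((f z.1 z.2)%:E * pair_law n x.+1 0%N [set z])
  + (p_ y - Num.min (p_ x) (p_ y))%:E * ((f z.1 z.2)%:E * pair_law n 0%N y.+1 [set z])
  + (1 - Num.max (p_ x) (p_ y))%:E * ((f z.1 z.2)%:E * pair_law n 0%N 0%N [set z]))).
  apply: eq_esum => z _; rewrite pair_lawS.
  rewrite !ge0_muleDr ?adde_ge0 ?mule_ge0 ?lee_fin//.
  by rewrite !(muleCA (f z.1 z.2)%:E).
rewrite !esumD; try by move=> z _; rewrite ?adde_ge0 ?mule_ge0 ?lee_fin.
rewrite !ge0_esumZl; try by []; try by move=> z.
by rewrite !IH -!EFinM -!EFinD.
Qed.

Lemma pair_law_fst n x y A : pair_law n x y (fst @^-1` A) = brt_law p_ x n A.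
Proof.
elim: n x y => [|n IH] x y; first by rewrite -[RHS]/(\d_x A) /= !diracE.
rewrite pair_lawS !IH brt_lawS//.
have mA : measurable A by [].
rewrite -(fineK (brt_law_fin p01 x.+1 n mA)) -(fineK (brt_law_fin p01 0%N n mA)).
rewrite -!EFinM -!EFinD; congr EFin.
have := addr_max_min (p_ x) (p_ y); move: (Num.min _ _) (Num.max _ _) => m M E.
have -> : M = (p_ x + p_ y - m)%R by rewrite -E addrK.
ring.
Qed.

Lemma pair_law_snd n x y A : pair_law n x y (snd @^-1` A) = brt_law p_ y n A.
Proof.
elim: n x y => [|n IH] x y; first by rewrite -[RHS]/(\d_y A) /= !diracE.
rewrite pair_lawS !IH brt_lawS//.
have mA : measurable A by [].
rewrite -(fineK (brt_law_fin p01 y.+1 n mA)) -(fineK (brt_law_fin p01 0%N n mA)).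
rewrite -!EFinM -!EFinD; congr EFin.
have := addr_max_min (p_ x) (p_ y); move: (Num.min _ _) (Num.max _ _) => m M E.
have -> : M = (p_ x + p_ y - m)%R by rewrite -E addrK.
ring.
Qed.

Definition distance_pow (p : R) (x y : nat) : R :=
  (`|x%:R - y%:R| `^ p)%R.

Lemma wasserstein_brt_law_le (p : R) i j k :
  wasserstein p (brt_law p_ i k) (brt_law p_ j k) <=
  (pair_iter p_ k (distance_pow p) i j)%:E `^ p^-1.
Proof.
have := @wasserstein_le_cost R p (brt_law p_ i k) (brt_law p_ j k)
  (pair_law k i j).
rewrite (@pair_law_esum k i j (distance_pow p)); last first.
  by move=> *; exact: powR_ge0.
apply; [|exact: pair_law_fst|exact: pair_law_snd].
by rewrite -(brt_lawT p01 i k) -(pair_law_fst k i j) preimage_setT.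
Qed.

Lemma wasserstein_invariant_le (p : R) (pi : probability nat R) i k :
  invariant_measure (brt_kernel p_) pi ->
  wasserstein p (brt_law p_ i k) pi <=
  (\sum_(0 <= y <oo) (pair_iter p_ k (distance_pow p) i y)%:E * pi [set y])
    `^ p^-1.
Proof.
move=> piP.
have r0 y : (0 <= fine (pi [set y]))%R by rewrite fine_ge0.
have piE y : pi [set y] = (fine (pi [set y]))%:E.
  by rewrite fineK// fin_num_measure.
(* The second copy starts from [pi]: the couplings from (i, y) are mixed with weights pi(y), and by
   invariance the second marginal is [pi] again. *)
pose Pi : {measure set (nat * nat)%type -> \bar R} :=
  mseries (fun y => mscale (NngNum (r0 y)) (pair_law k i y)) 0.
have PiE A : Pi A = \sum_(0 <= y <oo) pi [set y] * pair_law k i y A.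
  by apply: eq_eseriesr => y _; rewrite /= /mscale /= -piE.
have sum_pi : \sum_(0 <= y <oo) pi [set y] = 1.
  rewrite -(probability_setT pi) -(brt_law_invariant p01 piP 0 setT).
  by apply: eq_eseriesr => y _; rewrite brt_lawT// mul1e.
have Pif A : Pi (fst @^-1` A) = brt_law p_ i k A.
  have mA : measurable A by [].
  have lE := fineK (brt_law_fin p01 i k mA).
  rewrite PiE; under eq_eseriesr do rewrite pair_law_fst muleC -lE.
  by rewrite nneseriesZl// sum_pi mule1 lE.
have Pis A : Pi (snd @^-1` A) = pi A.
  rewrite PiE -(brt_law_invariant p01 piP k A).
  by apply: eq_eseriesr => y _; rewrite pair_law_snd muleC.
have Pi1 : Pi setT = 1 by rewrite -(preimage_setT fst) Pif brt_lawT.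
apply: (le_trans (wasserstein_le_cost p Pi1 Pif Pis)).
rewrite le_eqVlt; apply/orP; left; apply/eqP; congr (_ `^ _).
have d0 x y : (0 <= distance_pow p x y)%R by exact: powR_ge0.
transitivity (\esum_(z in [set: nat * nat]) \esum_(y in [set: nat])
    (fine (pi [set y]))%:E * ((distance_pow p z.1 z.2)%:E * pair_law k i y [set z])).
  apply: eq_esum => z _; rewrite PiE -nneseriesZl; last first.
    by move=> y _; rewrite mule_ge0.
  rewrite nneseries_esumT; last by move=> y; rewrite !mule_ge0 ?lee_fin.
  by apply: eq_esum => y _; rewrite -piE muleCA.
rewrite esum_exchange; last by move=> z y; rewrite !mule_ge0 ?lee_fin.
rewrite nneseries_esumT; last first.
  move=> y; rewrite mule_ge0// -(pair_law_esum k i y d0).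
  by apply: esum_ge0 => z _; rewrite mule_ge0 ?lee_fin.
apply: eq_esum => y _; rewrite ge0_esumZl//; last first.
  by move=> z; rewrite mule_ge0 ?lee_fin.
by rewrite pair_law_esum// -piE muleC.
Qed.

End pair_law.

(** * The invariant measure *)

Section nonneg_series.
Context {R : realType}.
Local Open Scope ereal_scope.

Lemma nneseries_le_bound (u : nat -> \bar R) (B : \bar R) :
  (forall n, 0 <= u n) -> (forall n, \sum_(0 <= k < n) u k <= B) ->
  \sum_(0 <= k <oo) u k <= B.
Proof.
move=> u0 uB; apply: lime_le; last exact: nearW.
exact: is_cvg_nneseries.
Qed.

Lemma nneseries_single (u : nat -> \bar R) (m : nat) : (forall n, 0 <= u n) ->
  (forall n, n != m -> u n = 0) -> \sum_(0 <= k <oo) u k = u m.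
Proof.
move=> u0 um; rewrite (nneseriesD1 (n := m))// eseries0 ?adde0// => i _.
by move=> /um.
Qed.

End nonneg_series.

Section invariant_mass.
Context {R : realType}.
Variables (p_ : nat -> R) (a : R) (i0 : nat) (pi : probability nat R).
Hypothesis p0 : forall i, 0 < p_ i.
Hypothesis p1 : forall i, p_ i <= 1.
Hypotheses (i00 : (0 < i0)%N) (a0 : 0 < a).
Hypothesis pE : forall i, (i0 <= i)%N -> p_ i = 1 - a / i%:R.
Hypothesis piP : invariant_measure (brt_kernel p_) pi.

Definition mass (n : nat) : R := fine (pi [set n]).

Lemma massE n : pi [set n] = (mass n)%:E.
Proof. by rewrite fineK// fin_num_measure. Qed.

Lemma mass_ge0 n : 0 <= mass n.
Proof. by rewrite fine_ge0. Qed.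

Lemma mass_le1 n : mass n <= 1.
Proof. by rewrite -lee_fin -massE probability_le1. Qed.

Let p01 i : 0 <= p_ i <= 1. Proof. by rewrite ltW//=. Qed.

(** The state n + 1 can be entered from n only. *)
Lemma massS n : mass n.+1 = p_ n * mass n.
Proof.
apply: EFin_inj; rewrite EFinM -!massE -[LHS](brt_law_invariant p01 piP 1).
rewrite (nneseries_single (m := n)).
- rewrite -[brt_law _ _ _ _]/(\int[\d_n]_x brt_kernel p_ x [set n.+1])%E.
  rewrite integral_dirac// diracT mul1e brt_kernelE// !diracE.
  by rewrite mem_set//= memNset//= mule1 mule0 adde0.
- by move=> m; rewrite mule_ge0.
- move=> m mn; rewrite -[brt_law _ _ _ _]/(\int[\d_m]_x brt_kernel p_ x [set n.+1])%E.
  rewrite integral_dirac// diracT mul1e brt_kernelE// !diracE.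
  rewrite memNset/=; last by move=> [] /eqP; exact/negP.
  by rewrite memNset//= !mule0 adde0 mul0e.
Qed.

Lemma mass_gt0 n : 0 < mass n.
Proof.
elim: n => [|n IH]; last by rewrite massS mulr_gt0.
rewrite lt_neqAle mass_ge0 andbT; apply/negP => /eqP m0.
have mass0 n : mass n = 0.
  by elim: n => [|n IH]; rewrite ?massS ?IH ?mulr0.
have := brt_law_invariant p01 piP 0 setT; rewrite probability_setT.
rewrite eseries0; first by move=> /eqP; rewrite eq_sym onee_eq0.
by move=> n _ _; rewrite massE mass0 mule0.
Qed.

(** From [i0] on, mass n * (n + 1) ^ a does not increase: the factor p_n is at most exp (- a / (n +
    1)), the growth of the power at most the inverse of that. *)
Lemma mass_upper n : mass n <= (i0.+1%:R) `^ a * n.+1%:R `^ (- a).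
Proof.
rewrite powRN ler_pdivlMr ?powR_gt0//.
elim: n => [|n IH].
  rewrite powR1 mulr1; apply: (le_trans (mass_le1 0)).
  apply: (@le_trans _ _ (1 `^ a)); first by rewrite powR1.
  by apply: (ge0_ler_powR (ltW a0)); rewrite ?nnegrE// ler1n.
have [ni|i_n] := ltnP n i0.
  rewrite -[leRHS]mul1r; apply: ler_pM; rewrite ?mass_ge0 ?powR_ge0 ?mass_le1//.
  by apply: (ge0_ler_powR (ltW a0)); rewrite ?nnegrE// ler_nat ltnS.
apply: le_trans IH; rewrite massS [_ * mass n]mulrC -mulrA ler_wpM2l ?mass_ge0//.
have n0 : 0 < n%:R :> R by rewrite ltr0n (leq_trans i00).
have r : n.+2%:R `^ a <= expR (a / n.+1%:R) * n.+1%:R `^ a.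
  have := @powR_ratio_le R n.+1%:R n.+2%:R a ltac:(by []) ltac:(by []) (ltW a0).
  have -> : (n.+2%:R - n.+1%:R) / n.+1%:R = n.+1%:R^-1 :> R.
    by rewrite -natrB ?leqnSn// subSnn mul1r.
  move=> h; apply: le_trans (ler_wpM2r (powR_ge0 _ _) h).
  by rewrite -powRM ?divr_ge0// divfK.
have pn : p_ n <= expR (- (a / n.+1%:R)).
  rewrite (pE i_n); apply: le_trans (expR_ge1Dx _).
  rewrite lerD2l lerN2 ler_wpM2l ?(ltW a0)//.
  by rewrite lef_pV2 ?posrE// ler_nat.
apply: le_trans (ler_pM (ltW (p0 n)) (powR_ge0 _ _) pn r) _.
by rewrite mulrA -expRD addNr expR0 mul1r.
Qed.

(** For the reverse bound, mass n * (n - (a + 1)) ^ a does not decrease. The shift is dictated by 1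
    - a / n = 1 / (1 + a / (n - a)) >= exp (- a / (n - a)), which matches the ratio of the powers of
    n - a - 1 and n - a. *)
Lemma mass_lower : exists c, exists2 n1 : nat, 0 < c &
  forall n, (n1 <= n)%N -> c * n%:R `^ (- a) <= mass n.
Proof.
have [m mP] := exists_natr_ge (a + 2).
pose n1 := (i0 + m)%N.
have n1R n : (n1 <= n)%N -> a + 2 <= n%:R.
  move=> nn; apply: (le_trans mP); rewrite ler_nat.
  by apply: leq_trans nn; exact: leq_addl.
have base n : (n1 <= n)%N -> 1 <= n%:R - (a + 1).
  by move=> /n1R; move: (a0); lra.
exists (mass n1 * (n1%:R - (a + 1)) `^ a); exists n1.
  by rewrite mulr_gt0 ?mass_gt0// powR_gt0//; have := base _ (leqnn n1); lra.
move=> n nn; rewrite powRN.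
have np : 0 < n%:R :> R by have := n1R _ nn; move: (a0); lra.
rewrite ler_pdivrMr ?powR_gt0//.
apply: (@le_trans _ _ (mass n * (n%:R - (a + 1)) `^ a)); last first.
  rewrite ler_wpM2l ?mass_ge0//; apply: (ge0_ler_powR (ltW a0)).
  - by rewrite nnegrE; have := base _ nn; lra.
  - by rewrite nnegrE ltW.
  - by move: (a0); lra.
elim: n nn {np} => [|n IH] nn; first by move: nn; rewrite leqn0 => /eqP ->.
move: nn; rewrite leq_eqVlt => /predU1P[<-//|]; rewrite ltnS => nn.
apply: (le_trans (IH nn)).
have b := base _ nn; have a0' := a0.
set y := n%:R - (a + 1) in b *.
have -> : n.+1%:R - (a + 1) = y + 1 by rewrite /y -(natr1 n); ring.
rewrite massS [p_ n * _]mulrC -mulrA ler_wpM2l ?mass_ge0//.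
have y0 : 0 < y by lra.
have y10 : 0 < y + 1 by lra.
have := powR_ratio_le y10 y0 (ltW a0).
have -> : a * ((y - (y + 1)) / (y + 1)) = - (a / (y + 1)).
  by field; rewrite gt_eqF.
have E : y = y / (y + 1) * (y + 1) by rewrite divfK// gt_eqF.
move=> h; rewrite {1}E powRM ?divr_ge0 ?(ltW y0) ?(ltW y10)//.
apply: ler_wpM2r; first exact: powR_ge0.
apply: (le_trans h).
have nE : n%:R = y + 1 + a by rewrite /y; ring.
rewrite pE ?nE; last by apply: leq_trans nn; exact: leq_addr.
rewrite expRN -[leRHS]invrK lef_pV2 ?posrE ?expR_gt0//; last first.
  by rewrite invr_gt0 subr_gt0 ltr_pdivrMr; lra.
apply: le_trans (expR_ge1Dx _).
have -> : 1 - a / (y + 1 + a) = (y + 1) / (y + 1 + a).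
  by field; rewrite gt_eqF//; lra.
rewrite invf_div le_eqVlt; apply/orP; left; apply/eqP.
by field; rewrite gt_eqF.
Qed.

Lemma moment_lty (q : R) : 0 <= q -> q < a - 1 -> (moment q pi < +oo)%E.
Proof.
move=> q0 qa; have s1 : 1 < a - q by lra.
set c := (i0.+1%:R) `^ a.
set B := c * (2 `^ (a - q) / (a - q - 1) * 1 `^ (1 - (a - q))).
apply: (@le_lt_trans _ _ B%:E); last exact: ltry.
rewrite /moment; apply: nneseries_le_bound => n; first by rewrite mule_ge0// lee_fin powR_ge0.
rewrite (eq_bigr (fun k => (k%:R `^ q * mass k)%:E)); last first.
  by move=> k _; rewrite /= massE.
rewrite sumEFin lee_fin.
have c0 : 0 <= c by exact: powR_ge0.
apply: le_trans (ler_wpM2l c0 (sum_powRN_le n s1 (lexx 1))).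
rewrite mulr_sumr; apply: ler_sum => k _.
apply: (@le_trans _ _ (k.+1%:R `^ q * (c * k.+1%:R `^ (- a)))).
  apply: ler_pM; rewrite ?powR_ge0 ?mass_ge0 ?mass_upper//.
  by apply: (ge0_ler_powR q0); rewrite ?nnegrE// ler_nat.
rewrite mulrCA -powRD; last by apply/implyP => _; rewrite gt_eqF.
by rewrite nat1r opprB addrC.
Qed.

End invariant_mass.

(** * Wasserstein bounds *)

Section transport_cost.
Context {R : realType}.
Variable p_ : nat -> R.
Hypothesis p01 : forall i, 0 <= p_ i <= 1.

Lemma pair_iterS n f x y :
  pair_iter p_ n.+1 f x y = pair_step p_ (pair_iter p_ n f) x y.
Proof. by []. Qed.

Lemma pair_iter_ge0 n f x y : (forall x y, 0 <= f x y) ->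
  0 <= pair_iter p_ n f x y.
Proof.
move=> f0; elim: n x y => [|n IH] x y //; rewrite pair_iterS.
have <- : pair_step p_ (fun _ _ => 0) x y = 0 by rewrite /pair_step; ring.
exact: pair_step_le.
Qed.

Lemma pair_iter_distance_le n x y p : 0 < p ->
  pair_iter p_ n (distance_pow p) x y <=
  ((maxn x y)%:R + n%:R) `^ p * pair_iter p_ n (fun x y => (x != y)%:R) x y.
Proof.
move=> p0; elim: n x y => [|n IH] x y.
  rewrite /= addr0 /distance_pow; have [->|xy] := eqVneq x y.
    by rewrite subrr normr0 powR0 ?mulr0// gt_eqF.
  rewrite mulr1; apply: (ge0_ler_powR (ltW p0)); rewrite ?nnegrE//.
  have := leq_maxl x y; have := leq_maxr x y.
  rewrite -!(ler_nat R) => h1 h2.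
  have x0 : 0 <= x%:R :> R by []. have y0 : 0 <= y%:R :> R by [].
  rewrite ler_norml; lra.
(* One step raises the maximum by at most 1 and uses up one unit of n, so the same [c] serves all
   four successors and passes through the linear operator. *)
rewrite !pair_iterS; set c := (_ + _) `^ p.
have -> : c * pair_step p_ (pair_iter p_ n (fun x y => (x != y)%:R)) x y =
    pair_step p_ (fun x y => c * pair_iter p_ n (fun x y => (x != y)%:R) x y) x y.
  by rewrite /pair_step; ring.
have H x' y' : (maxn x' y' <= (maxn x y).+1)%N ->
    pair_iter p_ n (distance_pow p) x' y' <=
    c * pair_iter p_ n (fun x y => (x != y)%:R) x' y'.
  move=> xy; apply: (le_trans (IH x' y')).
  rewrite ler_wpM2r ?pair_iter_ge0//.
  apply: (ge0_ler_powR (ltW p0)); rewrite ?nnegrE ?addr_ge0//.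
  by rewrite -!natrD ler_nat addnS -addSn leq_add2r.
by apply: pair_step_le => //; apply: H; lia.
Qed.

End transport_cost.

Section powers.
Context {R : realType}.
Implicit Types (t : R) (i j : nat).

Lemma powR_maxn_le t i j : 0 <= t ->
  (maxn i j).+1%:R `^ t <= i.+1%:R `^ t + j.+1%:R `^ t.
Proof.
by move=> t0; case: leqP => _; rewrite ?lerDl ?lerDr powR_ge0.
Qed.

Lemma powR_succ_le t i : 0 <= t -> i.+1%:R `^ t <= 2 `^ t * lyapunov t i.
Proof.
move=> t0; rewrite /lyapunov; case: i => [|i].
  have := @ler_powR R 2 ltac:(by rewrite ler1n) 0 t t0; rewrite powRr0 powR1.
  have : 0 <= 0 `^ t :> R by exact: powR_ge0.
  by move: (0 `^ t) (2 `^ t) => u v; nra.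
apply: (@le_trans _ _ (2 `^ t * i.+1%:R `^ t)).
  rewrite -powRM//; apply: (ge0_ler_powR t0); rewrite ?nnegrE ?mulr_ge0//.
  by rewrite -natrM ler_nat; lia.
by rewrite ler_wpM2l ?powR_ge0// lerDl.
Qed.

Lemma lyapunov_ge1 t i : 1 <= lyapunov t i.
Proof. by rewrite lerDr powR_ge0. Qed.

Lemma lyapunov_le s t i : 0 < s -> s <= t -> lyapunov s i <= lyapunov t i.
Proof.
move=> s0 st; rewrite lerD2r; case: i => [|i].
  by rewrite powR0 ?powR_ge0// gt_eqF.
by apply: ler_powR => //; rewrite ler1n.
Qed.

End powers.

Section upper_bounds.
Context {R : realType}.
Variables (p_ : nat -> R) (a : R) (i0 : nat) (pi : probability nat R).
Hypothesis p0 : forall i, 0 < p_ i.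
Hypothesis p0E : p_ 0%N = 1.
Hypothesis p1 : forall i, (0 < i)%N -> p_ i < 1.
Hypotheses (i00 : (0 < i0)%N).
Hypothesis pE : forall i, (i0 <= i)%N -> p_ i = 1 - a / i%:R.
Hypothesis piP : invariant_measure (brt_kernel p_) pi.

Let p_le1 i : p_ i <= 1.
Proof. by case: i => [|i]; [rewrite p0E|exact/ltW/p1]. Qed.

Let p01 i : 0 <= p_ i <= 1. Proof. by rewrite ltW/=. Qed.

Lemma transport_cost_le th : 0 < th -> th < a ->
  exists2 C, 0 < C & forall p k x y, 0 < p ->
    pair_iter p_ k (distance_pow p) x y <=
    C * ((maxn x y).+1%:R `^ th * ((maxn x y).+1%:R + k%:R) `^ (p - th)).
Proof.
move=> th0 tha.
have [C C0 CP] := pair_meeting_tail p0 p0E p1 pE th0 tha.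
exists C => // p k x y pp; apply: (le_trans (pair_iter_distance_le p01 k x y pp)).
set M := maxn x y; have k0 : 0 <= k%:R :> R by [].
have Mk0 : 0 < M.+1%:R + k%:R :> R by rewrite ltr_wpDr.
apply: (@le_trans _ _ ((M.+1%:R + k%:R) `^ p * (C *
    (M.+1%:R / (M.+1%:R + k%:R)) `^ th))).
  apply: ler_pM; rewrite ?powR_ge0 ?pair_iter_ge0 ?CP//.
  apply: (ge0_ler_powR (ltW pp)); rewrite ?nnegrE ?addr_ge0//.
  by rewrite lerD2r ler_nat.
rewrite powRM ?invr_ge0 ?(ltW Mk0)// -(powR_inv1 (ltW Mk0)) -powRrM mulN1r.
rewrite powRD; last by apply/implyP => _; rewrite gt_eqF.
rewrite le_eqVlt; apply/orP; left; apply/eqP; ring.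
Qed.

Lemma wasserstein_upper eta : 1 <= eta -> eta < a - 1 ->
  exists2 D, 0 < D & forall p k i, 1 <= p -> p <= eta ->
    (wasserstein p (brt_law p_ i k) pi <=
     (D * ((1 + k%:R) `^ (- ((eta - p) / p)) * lyapunov eta i))%:E)%E.
Proof.
move=> eta1 etaa; have eta0 : 0 < eta by lra.
have a0 : 0 < a by lra.
have [C C0 CP] := transport_cost_le eta0 ltac:(lra).
have : (moment eta pi < +oo)%E.
  exact: (moment_lty p0 p_le1 i00 a0 pE piP (ltW eta0) etaa).
have m0 : (0 <= moment eta pi)%E.
  by apply: nneseries_ge0 => n _ _; rewrite mule_ge0// lee_fin powR_ge0.
rewrite -ge0_fin_numE// => mfin; set m := fine (moment eta pi).
have mE : moment eta pi = m%:E by rewrite fineK.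
have mR0 : 0 <= m by rewrite -lee_fin -mE.
(* m + 2 comes from V(i) + 1 + m <= (m + 2) V(i), the integral of V(i) + y ^ eta + 1 less the common
   1 absorbed in V(i) >= 1. The maximum with 1 allows x ^ (1 / p) <= x for [D] and V(i), so the root
   acts on the power of 1 + k alone. *)
set D := Num.max 1 (C * (2 `^ eta * (m + 2))).
have D1 : 1 <= D by rewrite le_max lexx.
have DC : C * (2 `^ eta * (m + 2)) <= D by rewrite le_max lexx orbT.
exists D => [|p k i p1' peta]; first exact: lt_le_trans D1.
have pp : 0 < p by lra.
apply: (le_trans (wasserstein_invariant_le p01 p i k piP)).
have V1 := @lyapunov_ge1 R eta i.
set b := (1 + k%:R) `^ (p - eta).
have b0 : 0 <= b by exact: powR_ge0.
have cost y : pair_iter p_ k (distance_pow p) i y <=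
    C * b * 2 `^ eta * lyapunov eta i + C * b * 2 `^ eta * lyapunov eta y.
  apply: (le_trans (CP p k i y pp)).
  rewrite -!mulrA -mulrDr ler_wpM2l ?(ltW C0)// -mulrDr mulrC.
  apply: ler_pM; rewrite ?powR_ge0//.
    rewrite /b -(opprB eta p) !powRN lef_pV2 ?posrE ?powR_gt0 ?ltr_wpDr//.
    have ep : 0 <= eta - p by rewrite subr_ge0.
    apply: (ge0_ler_powR ep); rewrite ?nnegrE ?addr_ge0//.
    by rewrite lerD2r ler1n.
  apply: (le_trans (powR_maxn_le _ _ (ltW eta0))).
  by apply: lerD; apply: powR_succ_le; exact: ltW.
have sumE : (\sum_(0 <= y <oo) (pair_iter p_ k (distance_pow p) i y)%:E *
    pi [set y] <= (D * (b * lyapunov eta i))%:E)%E.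
  set K := C * b * 2 `^ eta in cost.
  have K0 : 0 <= K by rewrite !mulr_ge0 ?powR_ge0// ltW.
  have KV : 0 <= K * (lyapunov eta i + 1) by rewrite mulr_ge0//; lra.
  have tot : (\sum_(0 <= y <oo) pi [set y] = 1)%E.
    rewrite -(probability_setT pi) -(brt_law_invariant p01 piP 0 setT).
    by apply: eq_eseriesr => y _; rewrite brt_lawT// mul1e.
  apply: (@le_trans _ _ (\sum_(0 <= y <oo)
    ((K * (lyapunov eta i + 1))%:E * pi [set y] +
     K%:E * ((y%:R `^ eta)%:E * pi [set y])))%E).
    apply: lee_nneseries => [y _ _|y _].
      by rewrite mule_ge0// lee_fin pair_iter_ge0// => *; exact: powR_ge0.
    have Ky : 0 <= K * y%:R `^ eta by rewrite mulr_ge0 ?powR_ge0.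
    rewrite muleA -EFinM -ge0_muleDl ?lee_fin//.
    rewrite -EFinD lee_wpmul2r// lee_fin; apply: (le_trans (cost y)).
    by rewrite /lyapunov; lra.
  rewrite nneseriesD; last 2 first.
  - by move=> y _ _; rewrite mule_ge0// lee_fin.
  - by move=> y _ _; rewrite !mule_ge0// lee_fin ?powR_ge0.
  rewrite !nneseriesZl; last 2 first.
  - by move=> y _; rewrite mule_ge0// lee_fin powR_ge0.
  - by [].
  rewrite tot -/(moment eta pi) mE mule1 -EFinM -EFinD lee_fin.
  apply: (@le_trans _ _ ((C * (2 `^ eta * (m + 2))) * (b * lyapunov eta i))).
    have -> : C * (2 `^ eta * (m + 2)) * (b * lyapunov eta i) =
      K * ((m + 2) * lyapunov eta i) by rewrite /K; ring.
    by rewrite -mulrDr ler_wpM2l//; nra.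
  by rewrite ler_wpM2r// mulr_ge0//; lra.
have pge0 : 0 <= p^-1 by rewrite invr_ge0 ltW.
apply: (@le_trans _ _ ((D * (b * lyapunov eta i))%:E `^ p^-1)%E).
  apply: (gt0_ler_poweR pge0) => //; rewrite in_itv/= leey andbT.
    apply: nneseries_ge0 => y _ _; rewrite mule_ge0// lee_fin pair_iter_ge0//.
    by move=> *; exact: powR_ge0.
  by rewrite lee_fin !mulr_ge0//; lra.
rewrite poweR_EFin lee_fin.
have V0 : 0 <= lyapunov eta i by lra.
have D0 : 0 <= D by lra.
have le1 (x : R) : 1 <= x -> x `^ p^-1 <= x.
  move=> x1; rewrite -[leRHS]powRr1; last lra.
  by apply: ler_powR => //; rewrite invf_le1.
rewrite powRM ?mulr_ge0// powRM//.
apply: ler_pM; rewrite ?mulr_ge0 ?powR_ge0 ?le1//.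
apply: ler_pM; rewrite ?powR_ge0 ?le1//.
by rewrite /b -powRrM -mulNr opprB.
Qed.

End upper_bounds.

(** * Lower bound by the mass beyond the reach of the chain *)

Section wasserstein_lower.
Context {R : realType}.
Local Open Scope ereal_scope.

Lemma wasserstein_ge0 (p : R) (mu nu : {measure set nat -> \bar R}) :
  0 <= wasserstein p mu nu.
Proof. by apply: le_ereal_inf_tmp => _ [Pi _ <-]; exact: poweR_ge0. Qed.

Lemma wasserstein_ge_gap (p : R) (mu nu : {measure set nat -> \bar R})
    (L : nat) : (0 < p)%R -> mu [set x | (L <= x)%N] = 0 ->
  ((L%:R `^ p)%:E * nu [set y | (2 * L <= y < 4 * L)%N]) `^ p^-1
    <= wasserstein p mu nu.
Proof.
move=> p0 muL; apply: le_ereal_inf_tmp => _ [Pi [Pif Pis] <-].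
have pge0 : (0 <= p^-1)%R by rewrite invr_ge0 ltW.
have Lp0 : (0 <= L%:R `^ p)%R by exact: powR_ge0.
apply: (gt0_ler_poweR pge0).
- by rewrite in_itv/= leey andbT mule_ge0// lee_fin.
- rewrite in_itv/= leey andbT; apply: esum_ge0 => z _.
  by rewrite mule_ge0// lee_fin powR_ge0.
set B := [set y | _].
(* The upper end 4 L makes [S] finite, so that Pi S is a finite sum over atoms; on [S] the two
   coordinates differ by at least L. *)
pose S : set (nat * nat) := [set z | (z.1 < L)%N /\ (2 * L <= z.2 < 4 * L)%N].
have mz (z : nat * nat) : measurable [set z].
  have -> : [set z] = [set z.1] `*` [set z.2].
    apply/seteqP; split => [_ ->//|[u v] /= [-> ->]]; by case: z.
  exact: measurableX.
have Sfin : finite_set S.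
  apply: (@sub_finite_set _ _ (`I_L `*` `I_(4 * L))).
    by move=> [u v] /= [uL /andP[_ vL]].
  by apply: finite_setX; exact: finite_II.
have SE : S = \bigcup_(z in S) [set z]
    by apply/seteqP; split => [z|z [z' + /= ->//]]; exists z.
have mS : measurable S.
  by rewrite SE; apply: fin_bigcup_measurable.
have mf A : measurable (@fst nat nat @^-1` A).
  by rewrite -[X in measurable X]setTI; exact: measurable_fst.
have ms A : measurable (@snd nat nat @^-1` A).
  by rewrite -[X in measurable X]setTI; exact: measurable_snd.
have nuS : nu B <= Pi S.
  rewrite -(Pis B) /pushforward.
  have -> : Pi S = Pi S + Pi (fst @^-1` [set x | (L <= x)%N]).
    by rewrite [X in _ + X](Pif [set x | (L <= x)%N]) muL adde0.
  apply: le_trans (measureU2 _ mS (mf _)).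
  apply: le_measure; rewrite ?inE//; first exact: measurableU.
  move=> [u v] /= vB; case: (leqP L u) => uL; first by right.
  by left; split.
apply: (@le_trans _ _ ((L%:R `^ p)%:E * Pi S)).
  by rewrite lee_wpmul2l// lee_fin.
apply: (@le_trans _ _ ((L%:R `^ p)%:E * \esum_(z in S) Pi [set z])).
  rewrite lee_wpmul2l ?lee_fin// {1}SE measure_fin_bigcup//.
    by rewrite esum_fset.
  by move=> u v _ _ [w [-> ->]].
rewrite -ge0_esumZl// esum_mkcond.
apply: le_esum => z _; case: ifPn => [/set_mem[z1 z2]|_]; last first.
  by rewrite mule_ge0// lee_fin powR_ge0.
rewrite lee_wpmul2r// lee_fin; apply: (ge0_ler_powR (ltW p0)); rewrite ?nnegrE//.
have /andP[z2L _] := z2.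
have z2R : (2 * L%:R <= z.2%:R :> R)%R by rewrite -natrM ler_nat.
have z1R : (z.1%:R <= L%:R :> R)%R by rewrite ler_nat ltnW.
by rewrite distrC; apply: le_trans (ler_norm _); lra.
Qed.

End wasserstein_lower.

Section brt_bounds.
Context {R : realType}.
Variables (p_ : nat -> R) (a : R) (i0 : nat) (pi : probability nat R).
Hypothesis p0 : forall i, 0 < p_ i.
Hypothesis p0E : p_ 0%N = 1.
Hypothesis p1 : forall i, (0 < i)%N -> p_ i < 1.
Hypotheses (i00 : (0 < i0)%N).
Hypothesis pE : forall i, (i0 <= i)%N -> p_ i = 1 - a / i%:R.
Hypothesis piP : invariant_measure (brt_kernel p_) pi.

Let p_le1 i : p_ i <= 1.
Proof. by case: i => [|i]; [rewrite p0E|exact/ltW/p1]. Qed.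

Let p01 i : 0 <= p_ i <= 1. Proof. by rewrite ltW/=. Qed.

(** The tail is used with an exponent th' halfway between th and a. The summand then decays like (M
    + k) ^ (- s) with s = 1 + th' - th > 1, and summing turns the prefactor M ^ th' back into M ^
    th. *)
Lemma wasserstein_sum_upper th : 2 <= th -> th < a ->
  exists2 C, 0 < C & forall i j,
    (\sum_(0 <= k <oo) (((1 + k%:R) `^ (th - 2))%:E *
        wasserstein 1 (brt_law p_ i k) (brt_law p_ j k))
     <= (C * (lyapunov th i + lyapunov th j))%:E)%E.
Proof.
move=> th2 tha; set th' := (th + a) / 2.
have [C C0 CP] := transport_cost_le p0 p0E p1 pE
  (ltac:(rewrite /th'; lra) : 0 < th') (ltac:(rewrite /th'; lra) : th' < a).
set s := th' - th + 1; have s1 : 1 < s by rewrite /s /th'; lra.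
set K := 2 `^ s / (s - 1).
have K0 : 0 < K by rewrite divr_gt0 ?powR_gt0//; lra.
exists (C * K * 2 `^ th); first by rewrite (mulr_gt0 (mulr_gt0 C0 K0)) ?powR_gt0.
move=> i j; apply: nneseries_le_bound => n.
  by rewrite mule_ge0 ?wasserstein_ge0// lee_fin powR_ge0.
set M := (maxn i j).+1.
have M1 : 1 <= M%:R :> R by rewrite ler1n.
have W1 k : (wasserstein 1 (brt_law p_ i k) (brt_law p_ j k) <=
    (C * (M%:R `^ th' * (M%:R + k%:R) `^ (1 - th')))%:E)%E.
  apply: (le_trans (wasserstein_brt_law_le p01 1 i j k)).
  rewrite invr1 poweRe1 ?lee_fin ?CP// pair_iter_ge0// => *; exact: powR_ge0.
apply: (@le_trans _ _ (\sum_(0 <= k < n)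
    (C * M%:R `^ th' * (M%:R + k%:R) `^ (- s))%:E)%E).
  apply: lee_sum => k _.
  have w0 : 0 <= (1 + k%:R) `^ (th - 2) :> R by exact: powR_ge0.
  apply: (@le_trans _ _ (((1 + k%:R) `^ (th - 2))%:E *
      (C * (M%:R `^ th' * (M%:R + k%:R) `^ (1 - th')))%:E)%E).
    by rewrite lee_wpmul2l// lee_fin.
  rewrite -EFinM lee_fin mulrCA -mulrA ler_wpM2l ?(ltW C0)//.
  rewrite mulrCA ler_wpM2l ?powR_ge0//.
  have -> : - s = (th - 2) + (1 - th') by rewrite /s; ring.
  rewrite (@powRD _ (M%:R + k%:R) (th - 2) (1 - th')); last first.
    by apply/implyP => _; rewrite gt_eqF// ltr_wpDr//; lra.
  rewrite ler_wpM2r ?powR_ge0//.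
  have th20 : 0 <= th - 2 by lra.
  by apply: (ge0_ler_powR th20); rewrite ?nnegrE ?addr_ge0// lerD2r.
rewrite sumEFin lee_fin -mulr_sumr.
have CM0 : 0 <= C * M%:R `^ th' by rewrite mulr_ge0 ?powR_ge0// ltW.
apply: (le_trans (ler_wpM2l CM0 (sum_powRN_le n s1 M1))).
rewrite -/K.
have -> : C * M%:R `^ th' * (K * M%:R `^ (1 - s)) = C * K * M%:R `^ th.
  have -> : M%:R `^ th = M%:R `^ th' * M%:R `^ (1 - s) :> R.
    rewrite -powRD; last by apply/implyP => _; rewrite gt_eqF//; lra.
    by congr (_ `^ _); rewrite /s; ring.
  ring.
have CK0 : 0 <= C * K by rewrite mulr_ge0 ?ltW.
rewrite -[leRHS]mulrA ler_wpM2l//.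
have th0 : 0 <= th by lra.
apply: (le_trans (powR_maxn_le _ _ th0)).
by rewrite mulrDr; apply: lerD; exact: powR_succ_le.
Qed.

Lemma mass_interval_ge (d : R) N n :
  (forall m, (N <= m < N + n)%N -> d <= mass pi m) ->
  ((n%:R * d)%:E <= pi [set m | (N <= m < N + n)%N])%E.
Proof.
elim: n => [|n IH] dP; first by rewrite mul0r.
have -> : [set m | (N <= m < N + n.+1)%N] =
    [set m | (N <= m < N + n)%N] `|` [set (N + n)%N].
  apply/seteqP; split => [m /=|m [/=|/= ->]].
  - by have [->|mn] := eqVneq m (N + n)%N; [right|left; lia].
  - by lia.
  - by lia.
rewrite measureU//; last first.
  by apply/seteqP; split => // m [/= + mE]; rewrite mE; lia.
rewrite -natr1 mulrDl mul1r EFinD; apply: leeD.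
  by apply: IH => m mn; apply: dP; lia.
apply: (@le_trans _ _ (mass pi (N + n))%:E); last by rewrite -massE.
by rewrite lee_fin dP//; lia.
Qed.

Lemma wasserstein_lower p i : 0 < a -> 1 <= p -> p <= a - 1 ->
  exists2 c : R, 0 < c & forall k : nat,
    ((c * (1 + k%:R) `^ (- ((a - 1 - p) / p)))%:E <=
       wasserstein p (brt_law p_ i k) pi)%E.
Proof.
move=> a0 p1' pa; have pp : 0 < p by lra.
have pge0 : 0 <= p^-1 by rewrite invr_ge0 ltW.
have [c [n1 c0 cP]] := mass_lower p0 p_le1 a0 pE piP.
(* [B] converts [L] below into a power of 1 + k, through L <= B (1 + k). *)
set B := (i + n1).+1; set e := (a - 1 - p) / p.
have e0 : 0 <= e by rewrite divr_ge0//; lra.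
have c40 : 0 < c * 4 `^ (- a) by rewrite mulr_gt0// powR_gt0.
exists ((c * 4 `^ (- a)) `^ p^-1 * B%:R `^ (- e)).
  by rewrite mulr_gt0// powR_gt0.
(* Beyond i + k, the reach of the chain, and beyond [n1], where the lower bound on the masses
   holds. *)
move=> k; set L := (i + k + n1).+1.
have L0 : 0 < L%:R :> R by [].
have supp : brt_law p_ i k [set x | (L <= x)%N] = 0%E.
  by apply: (brt_law_support p01) => x xk /=; rewrite /L; lia.
apply: le_trans (wasserstein_ge_gap pi pp supp).
have piB : ((L%:R * (c * (4 * L%:R) `^ (- a)))%:E <=
    pi [set y | (2 * L <= y < 4 * L)%N])%E.
  have -> : (4 * L = 2 * L + 2 * L)%N by lia.
  apply: le_trans (mass_interval_ge (d := c * (4 * L%:R) `^ (- a)) _).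
    rewrite lee_fin ler_wpM2r ?mulr_ge0 ?powR_ge0 ?(ltW c0)//.
    by rewrite ler_nat; lia.
  move=> m mL; apply: le_trans (cP m _); last by rewrite /L in mL; lia.
  have m0 : 0 < m%:R :> R by rewrite ltr0n; rewrite /L in mL; lia.
  have L40 : 0 < 4 * L%:R :> R by rewrite mulr_gt0.
  rewrite ler_wpM2l ?(ltW c0)// !powRN lef_pV2 ?posrE ?powR_gt0//.
  apply: (ge0_ler_powR (ltW a0)); rewrite ?nnegrE ?(ltW m0) ?(ltW L40)//.
  by rewrite -natrM ler_nat; lia.
have X0 : 0 <= L%:R `^ p * (L%:R * (c * (4 * L%:R) `^ (- a))).
  by rewrite !mulr_ge0 ?powR_ge0 ?(ltW c0).
apply: (@le_trans _ _ ((L%:R `^ p * (L%:R * (c * (4 * L%:R) `^ (- a))))%:E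
    `^ p^-1)%E); last first.
  apply: (gt0_ler_poweR pge0).
  - by rewrite in_itv/= leey andbT lee_fin.
  - by rewrite in_itv/= leey andbT mule_ge0// lee_fin powR_ge0.
  - by rewrite EFinM lee_wpmul2l// lee_fin powR_ge0.
rewrite poweR_EFin lee_fin.
have -> : L%:R `^ p * (L%:R * (c * (4 * L%:R) `^ (- a))) =
    (c * 4 `^ (- a)) * L%:R `^ (- (a - 1 - p)).
  rewrite powRM//.
  have -> : L%:R `^ (- (a - 1 - p)) = L%:R `^ p * L%:R * L%:R `^ (- a) :> R.
    rewrite -{3}(@powRr1 _ L%:R)// -!powRD; try by apply/implyP => _; rewrite gt_eqF.
    by congr (_ `^ _); ring.
  ring.
rewrite [leRHS]powRM ?powR_ge0 ?(ltW c40)// -powRrM mulNr -/e.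
rewrite -mulrA ler_wpM2l ?powR_ge0//.
rewrite -powRM ?addr_ge0// !powRN lef_pV2 ?posrE ?powR_gt0 ?mulr_gt0 ?ltr_wpDr//.
apply: (ge0_ler_powR e0); rewrite ?nnegrE ?mulr_ge0 ?addr_ge0//.
by rewrite nat1r -natrM ler_nat /L /B; lia.
Qed.

End brt_bounds.

(** With a = 1 + alpha, the range of beta says 2 <= theta < a, hence 1 <= eta < alpha. All weights
    are compared with powers of 1 + k by means of r(k) <= (1 + k) ^ eta, and V dominates i ^ eta +
    1. *)
Theorem proposition3p8 (R : realType) (p_ : nat -> R) (i0 : nat) (alpha : R)
    (pi : probability nat R) :
  brt_params p_ ->
  (0 < i0)%N -> 1 < alpha ->
  (forall i : nat, (i0 <= i)%N -> p_ i = 1 - (1 + alpha) / i%:R) ->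
  invariant_measure (brt_kernel p_) pi ->
  (forall beta : R, 2 / (1 + alpha) <= beta -> beta < 1 ->
    let theta := beta * (1 + alpha) in
    let eta := theta - 1 in
    let V := lyapunov theta in
    let r := rate theta in
    (exists cbar : R, 0 < cbar /\
      (forall k i : nat,
        ((Num.max 1 (r k%:R `^ ((eta - 1) / eta)))%:E
          * wasserstein 1 (brt_law p_ i k) pi <= (cbar * V i)%:E)%E) /\
      (forall i j : nat,
        (\sum_(0 <= k <oo)
            ((Num.max 1 (r k%:R `^ ((eta - 1) / eta)))%:E
              * wasserstein 1 (brt_law p_ i k) (brt_law p_ j k))
          <= (cbar * (V i + V j))%:E)%E)) /\
    (forall p : R, 1 <= p -> p <= eta ->
      exists ctilde : R, 0 < ctilde /\
        forall k i : nat,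
          (maxe 1 (mine (natpow k ((eta - p) / p))
                        (natpow k ((1 - p) / p)
                          * (r k%:R `^ ((eta - 1) / (p * eta)))%:E))
            * wasserstein p (brt_law p_ i k) pi
           <= ctilde%:E * ((V i)%:E + moment eta pi))%E)) /\
  (forall iota : R, 0 < iota -> iota < alpha ->
    (moment (alpha - iota) pi < +oo)%E) /\
  (forall rho eps : R,
    0 < rho -> rho < Num.min (alpha - 1) 1 -> rho <= eps -> eps < 1 ->
    let theta := 1 + alpha - rho in
    let vartheta := alpha - rho in
    let V := lyapunov theta in
    forall (p iota : R) (i : nat),
      1 <= p -> p <= alpha - rho -> 0 < iota -> iota < 1 - eps ->
      exists (cbar : R) (t : nat -> nat),
        [/\ 0 < cbar,
            forall m n : nat, (m < n)%N -> (t m < t n)%N,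
            t n @[n --> \oo] --> \oo
          & forall n : nat,
              ((cbar * ((t n)%:R + V i)
                  `^ (- ((vartheta - p + eps + iota)
                         / ((theta - vartheta - eps - iota) * p))))%:E
               <= wasserstein p (brt_law p_ i (t n)) pi)%E]).
Proof.
move=> [p0 p0E p1 _] i00 alpha1 pE piP.
have a0 : 0 < 1 + alpha by lra.
split; [|split].
- move=> beta beta_ge beta_lt theta eta V r.
  have theta2 : 2 <= theta by rewrite /theta -ler_pdivrMr.
  have theta_lt : theta < 1 + alpha by rewrite /theta gtr_pMl.
  have eta1 : 1 <= eta by rewrite /eta; lra.
  have eta_lt : eta < 1 + alpha - 1 by rewrite /eta; lra.
  have theta1 : 1 < theta by lra.
  have weight_le (k : nat) (e : R) : 0 <= e ->
      r k%:R `^ (e / eta) <= (1 + k%:R) `^ e.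
    move=> e0; rewrite /r rateE// -/eta -powRrM [eta * _]mulrC divfK; last first.
      by rewrite gt_eqF//; lra.
    have kt0 : 0 <= k%:R / theta by rewrite divr_ge0//; lra.
    apply: (ge0_ler_powR e0); rewrite ?nnegrE ?addr_ge0//.
    by rewrite lerD2l ler_pdivrMr ?ler_peMr//; lra.
  have weight1_le (k : nat) (e : R) : 0 <= e ->
      Num.max 1 (r k%:R `^ (e / eta)) <= (1 + k%:R) `^ e.
    move=> e0; rewrite ge_max weight_le// andbT.
    apply: (@le_trans _ _ (1 `^ e)); first by rewrite powR1.
    by apply: (ge0_ler_powR e0); rewrite ?nnegrE ?addr_ge0// lerDl.
  have V1 i : 1 <= V i by exact: lyapunov_ge1.
  have Veta i : lyapunov eta i <= V i.
    by apply: lyapunov_le; rewrite /eta; lra.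
  have e10 : 0 <= eta - 1 by lra.
  split.
    have [D D0 DP] := wasserstein_upper p0 p0E p1 i00 pE piP eta1 eta_lt.
    have [C C0 CP] := wasserstein_sum_upper p0 p0E p1 pE theta2 theta_lt.
    exists (Num.max D C); split; first by rewrite lt_max D0.
    split=> [k i|i j].
      apply: (@le_trans _ _ (((1 + k%:R) `^ (eta - 1))%:E *
          (D * ((1 + k%:R) `^ (- ((eta - 1) / 1)) * lyapunov eta i))%:E)%E).
        apply: lee_pmul; rewrite ?wasserstein_ge0 ?DP//.
        by rewrite lee_fin weight1_le.
      rewrite divr1 powRN -EFinM lee_fin mulrCA mulVKf ?gt_eqF ?powR_gt0 ?ltr_wpDr//.
      by apply: ler_pM; rewrite ?(ltW D0)// ?le_max ?lexx// (le_trans ler01) ?lyapunov_ge1.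
    apply: (@le_trans _ _ (C * (V i + V j))%:E); last first.
      rewrite lee_fin ler_wpM2r ?le_max ?lexx ?orbT//.
      by have := V1 i; have := V1 j; lra.
    apply: le_trans (CP i j); apply: lee_nneseries => [k _ _|k _].
      by rewrite mule_ge0 ?wasserstein_ge0// lee_fin le_max ler01.
    rewrite lee_wpmul2r ?wasserstein_ge0// lee_fin.
    have -> : theta - 2 = eta - 1 by rewrite /eta; ring.
    exact: weight1_le.
  move=> p p1' peta; have pp : 0 < p by lra.
  have [D D0 DP] := wasserstein_upper p0 p0E p1 i00 pE piP eta1 eta_lt.
  exists D; split=> // k i.
  have ep0 : 0 <= (eta - p) / p by rewrite divr_ge0//; lra.
  have one_le : 1 <= (1 + k%:R) `^ ((eta - p) / p).
    apply: (@le_trans _ _ (1 `^ ((eta - p) / p))); first by rewrite powR1.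
    by apply: (ge0_ler_powR ep0); rewrite ?nnegrE ?addr_ge0// lerDl.
  (* A nonnegative exponent keeps this entry finite also at k = 0, and it bounds the minimum, whose
     other entry may be +oo there. *)
  have np : natpow k ((eta - p) / p) = (k%:R `^ ((eta - p) / p))%:E.
    by rewrite /natpow ltNge ep0 andbF.
  apply: (@le_trans _ _ (((1 + k%:R) `^ ((eta - p) / p))%:E *
      (D * ((1 + k%:R) `^ (- ((eta - p) / p)) * lyapunov eta i))%:E)%E).
    apply: lee_pmul; rewrite ?wasserstein_ge0 ?DP//.
      by rewrite le_max lee_fin ler01.
    rewrite ge_max lee_fin one_le /= np.
    apply: (@le_trans _ _ (k%:R `^ ((eta - p) / p))%:E).
      by rewrite ge_min lexx.
    rewrite lee_fin; apply: (ge0_ler_powR ep0); rewrite ?nnegrE ?addr_ge0//.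
    by rewrite lerDr.
  rewrite powRN -EFinM mulrCA mulVKf ?gt_eqF ?powR_gt0 ?ltr_wpDr//.
  rewrite EFinM lee_wpmul2l ?lee_fin ?(ltW D0)//.
  apply: (@le_trans _ _ (V i)%:E); first by rewrite lee_fin.
  rewrite leeDl//; apply: nneseries_ge0 => y _ _.
  by rewrite mule_ge0// lee_fin powR_ge0.
- move=> iota iota0 iota_lt.
  have p_le1 i : p_ i <= 1 by case: i => [|i]; [rewrite p0E|exact/ltW/p1].
  by apply: (moment_lty p0 p_le1 i00 a0 pE piP); lra.
- move=> rho eps rho0; rewrite lt_min => /andP[rho_a rho1] rho_eps eps1.
  move=> theta vartheta V p iota i p1' pa iota0 iota1.
  have [c c0 cP] := wasserstein_lower p0 p0E p1 i00 pE piP i a0 p1'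
    (ltac:(lra) : p <= 1 + alpha - 1).
  have pp : 0 < p by lra.
  exists c, id; split => // n.
  apply: le_trans (cP n); rewrite lee_fin ler_wpM2l ?(ltW c0)//.
  set E := _ / (_ * p); set e := _ / p.
  have V1 : 1 <= V i by exact: lyapunov_ge1.
  have n0 : 0 <= n%:R :> R by [].
  (* Since rho <= eps and 0 < 1 - eps - iota < 1, [E] has the larger numerator and the smaller
     denominator. The base n + V(i) is at least 1, so the bound with exponent [e] is the stronger
     one. *)
  have eE : e <= E.
    rewrite /e /E ler_pdivrMr// invfM mulrA -[_ / _ / _ * _]mulrA mulVf ?gt_eqF//.
    rewrite mulr1 ler_pdivlMr /theta /vartheta; nra.
  have e0 : 0 <= e by rewrite divr_ge0//; lra.
  apply: (@le_trans _ _ ((n%:R + V i) `^ (- e))).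
    by apply: ler_powR; lra.
  rewrite !powRN lef_pV2 ?posrE ?powR_gt0; try lra.
  by apply: (ge0_ler_powR e0); rewrite ?nnegrE; lra.
Qed.
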